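(* Let $x_1,\dots,x_n\in\mathbb{R}^p$ be fixed (deterministic) and satisfy $(\epsilon,L,U)$-weak stability for some $\epsilon\in(0,1)$ and $L,U>0$. Suppose $y_i=x_i^T\beta^*+z_i$ for $1\le i\le n$, where $\beta^*\in\mathbb{R}^p$ and the errors $z_1,\dots,z_n$ are sampled i.i.d. from a symmetric distribution on $\mathbb{R}$. Let $\tau\in(0,1)$ be such that $\frac{\log(1/\tau)}{n}=O(\epsilon)$, and let $\gamma>0$ be such that $\mathbb{P}(|z_i|\ge\gamma/2)=O(\epsilon)$. Let $\widehat\beta_{H,\gamma}\in\arg\min_{\beta\in\mathbb{R}^p}\mathcal{L}_\gamma(\beta)$. Then with probability at least $1-\tau$, $$\|\widehat\beta_{H,\gamma}-\beta^*\|_2\lesssim\frac{\gamma\sqrt U}{L}\left(\sqrt{\frac pn}+\sqrt{\frac{\log(1/\tau)}{n}}\right),\quad\text{as long as } n=\Omega\left(\frac{U^2(p+\log(1/\tau))}{L^2\epsilon^2}\right).$$ Furthermore, $\mathcal{L}_\gamma$ is $L$-strongly convex in a ball of radius $\Omega(\epsilon\gamma/\sqrt U)$ around $\widehat\beta_{H,\gamma}$.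
   Context: Weak stability: for $\epsilon\in(0,1)$, points $x_1,\dots,x_n\in\mathbb{R}^p$ satisfy $(\epsilon,L,U)$-weak stability if for every $S\subseteq[n]=\{1,\dots,n\}$ with $|S|\ge(1-\epsilon)n$, $L\le\lambda_{\min}\left(\frac1n\sum_{i\in S}x_ix_i^T\right)\le\lambda_{\max}\left(\frac1n\sum_{i\in S}x_ix_i^T\right)\le U$. Huber loss: $\ell_\gamma(x)=x^2/2$ if $|x|\le\gamma$ and $\ell_\gamma(x)=\gamma|x|-\gamma^2/2$ if $|x|>\gamma$. Objective: $\mathcal{L}_\gamma(\beta)=\frac1n\sum_{i=1}^n\ell_\gamma(y_i-x_i^T\beta)$. Strong convexity: a continuously differentiable $f$ on a convex set $\mathcal X$ is $\alpha$-strongly convex if $f(y)\ge f(x)+\langle\nabla f(x),y-x\rangle+\frac\alpha2\|y-x\|_2^2$ for all $x,y\in\mathcal X$. Constants: all implied constants are positive and absolute. In the hypotheses, $A=O(B)$ means $A\le cB$ for a sufficiently small absolute constant $c$, and $A=\Omega(B)$ means $A\ge C'B$ for a sufficiently large absolute constant $C'$. In conclusions, $\lesssim$ and $\Omega(\cdot)$ mean up to some absolute constant. *)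

(* Defs.v *)
From HB Require Import structures.
From mathcomp Require Import all_boot all_order all_algebra.
From mathcomp Require Import all_classical all_reals all_analysis.
Set Implicit Arguments.
Unset Strict Implicit.
Unset Printing Implicit Defensive.
Import Order.TTheory GRing.Theory Num.Theory.
Import numFieldNormedType.Exports.
Local Open Scope classical_set_scope.
Local Open Scope ring_scope.

Definition dot (R : realType) (p : nat) (u v : 'cV[R]_p) : R :=
  \sum_(i < p) u i 0 * v i 0.

(* The library norm `|u| on matrices is the sup norm; it induces the same
   topology, so differentiability and continuity below are the usual ones. *)
Definition norm2 (R : realType) (p : nat) (u : 'cV[R]_p) : R :=
  Num.sqrt (dot u u).

Definition ball2 (R : realType) (p : nat) (c : 'cV[R]_p) (r : R) :
  set 'cV[R]_p := [set b | norm2 (b - c) <= r].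

(* Used only for symmetric real matrices of size p > 0, whose spectrum is
   nonempty and finite, so that inf and sup are attained; for p = 0 the
   spectrum is empty and both values are 0. *)
Definition lambda_min (R : realType) (p : nat) (A : 'M[R]_p) : R :=
  inf [set a | eigenvalue A a].

Definition lambda_max (R : realType) (p : nat) (A : 'M[R]_p) : R :=
  sup [set a | eigenvalue A a].

Definition second_moment (R : realType) (n p : nat) (x : 'I_n -> 'cV[R]_p)
    (S : {set 'I_n}) : 'M[R]_p :=
  n%:R^-1 *: \sum_(i in S) x i *m (x i)^T.

Definition weak_stability (R : realType) (n p : nat) (eps L U : R)
    (x : 'I_n -> 'cV[R]_p) : Prop :=
  forall S : {set 'I_n}, (1 - eps) * n%:R <= #|S|%:R ->
    [/\ L <= lambda_min (second_moment x S),
        lambda_min (second_moment x S) <= lambda_max (second_moment x S)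
      & lambda_max (second_moment x S) <= U].

Definition huber (R : realType) (gamma t : R) : R :=
  if `|t| <= gamma then t ^+ 2 / 2 else gamma * `|t| - gamma ^+ 2 / 2.

Definition huber_objective (R : realType) (n p : nat) (gamma : R)
    (x : 'I_n -> 'cV[R]_p) (y : 'I_n -> R) (beta : 'cV[R]_p) : R :=
  n%:R^-1 * \sum_(i < n) huber gamma (y i - dot (x i) beta).

Definition argmin (R : realType) (V : Type) (f : V -> R) : set V :=
  [set b | forall b', f b <= f b'].

Definition gradient (R : realType) (p : nat) (f : 'cV[R]_p -> R)
    (b : 'cV[R]_p) : 'cV[R]_p :=
  \col_(i < p) 'D_(delta_mx i 0) f b.

Definition strongly_convex (R : realType) (p : nat) (alpha : R)
    (X : set 'cV[R]_p) (f : 'cV[R]_p -> R) : Prop :=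
  [/\ convex_set X,
      forall b, X b -> differentiable f b,
      {within X, continuous (gradient f)}
    & forall b b', X b -> X b' ->
        f b + dot (gradient f b) (b' - b) + alpha / 2 * norm2 (b' - b) ^+ 2
          <= f b'].

Definition mutually_independent (R : realType) (d : measure_display)
    (T : measurableType d) (P : probability T R) (I : finType)
    (X : I -> {RV P >-> R}) : Prop :=
  forall (J : {set I}) (A : I -> set R),
    (forall i, measurable (A i)) ->
    P (\bigcap_(i in [set` J]) (X i @^-1` A i)) =
    (\prod_(i in J) P (X i @^-1` A i))%E.

Definition symmetric_law (R : realType) (D : probability R R) : Prop :=
  forall A : set R, measurable A -> D (-%R @^-1` A) = D A.

Definition iid (R : realType) (d : measure_display) (T : measurableType d)
    (P : probability T R) (I : finType) (D : probability R R)
    (X : I -> {RV P >-> R}) : Prop :=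
  mutually_independent X /\
  forall i (A : set R), measurable A -> distribution P (X i) A = D A.

(* Main.v *)
Require Import Defs.
From HB Require Import structures.
From mathcomp Require Import all_boot all_order all_algebra.
From mathcomp Require Import all_classical all_reals all_analysis.
From mathcomp Require Import measurable_realfun ring lra.

(** Write v for a displacement from the true parameter and g for the gradient
of the objective at the true parameter.  The theorem combines a deterministic
fact about the objective with two probabilistic facts about the errors.

Deterministic part.  The Huber loss is convex, its derivative is the
1-Lipschitz truncation [clip], and it is exactly quadratic on [-gamma, gamma].
If at most eps n / 2 errors reach gamma / 2 and |v| is at most
r = eps gamma / (4 sqrt U), then for all but an eps fraction of the indices
both the error and the shift <x_i, v> are at most gamma / 2: the upper half of
weak stability bounds the sum of the <x_i, v>^2, hence the number of indices
with a large shift.  On the remaining indices the loss is quadratic, and the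
lower half of weak stability, applied to that set of indices, makes the
objective L-strongly convex in the ball of radius r around the true parameter
([huber_objective_locally_strongly_convex]).  A minimizer v inside this ball
satisfies L |v|^2 / 2 <= |g| |v|, so |v| <= 2 |g| / L; convexity excludes a
minimizer outside the ball as soon as 2 |g| / L < r ([minimizer_error]).
Strong convexity around the estimator follows, because a ball of half the
radius around it lies in the ball of radius r around the true parameter.

The inequalities for quadratic forms that weak stability contains are stated
through eigenvalues.  They are recovered from the infimum mu of the Rayleigh
quotient of a symmetric matrix A: if A - mu were invertible, the
Cauchy-Schwarz inequality for the nonnegative form A - mu would push that
infimum strictly above mu ([symmetric_min_eigenvalue]).

Probabilistic part.  The number of large errors is controlled by its
exponential moment ([outliers_expectation_le]).  For the score
u = sum_i clip(z_i) x_i, every projection <k, u> is sub-Gaussian with variance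
proxy of order gamma^2 n U |k|^2, because the truncated errors are bounded by
gamma and symmetric.  The norm |u| is bounded at the optimal rate
sqrt p + sqrt (log (1/tau)) by summing exp(s <k, u> - (1 + c) |k|^2) over the
integer vectors k: this discrete analogue of a Gaussian average has
expectation at most exp(2 p) when c |k|^2 absorbs the exponential moment, and
one of its terms, with k nearly parallel to u and |k|^2 <= 4 p, is at least
exp(s sqrt p |u| - 4 (1 + c) p).  One application of the Markov inequality to
the average of the two normalised moments produces the event
([good_noise_event]).

Independence enters through [ge0_integral_prod_indep]: the expectation of a
product of functions of independent variables is the product of the
expectations. *)

Set Implicit Arguments.
Unset Strict Implicit.
Unset Printing Implicit Defensive.
Import Order.TTheory GRing.Theory Num.Theory.
Import numFieldNormedType.Exports.
Local Open Scope classical_set_scope.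
Local Open Scope ring_scope.

(** * Euclidean geometry of column vectors *)

Section euclidean_space.
Variables (R : realType) (p : nat).
Implicit Types (u v w : 'cV[R]_p) (a : R).

Lemma dotE u v : dot u v = (u^T *m v) 0 0.
Proof. by rewrite mxE; apply: eq_bigr => i _; rewrite mxE. Qed.

Lemma dotC u v : dot u v = dot v u.
Proof. by apply: eq_bigr => i _; rewrite mulrC. Qed.

Lemma dotDr u v w : dot u (v + w) = dot u v + dot u w.
Proof. by rewrite !dotE mulmxDr mxE. Qed.

Lemma dotZr a u v : dot u (a *: v) = a * dot u v.
Proof. by rewrite !dotE -scalemxAr mxE. Qed.

Lemma dotNr u v : dot u (- v) = - dot u v.
Proof. by rewrite !dotE mulmxN mxE. Qed.

Lemma dotBr u v w : dot u (v - w) = dot u v - dot u w.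
Proof. by rewrite dotDr dotNr. Qed.

Lemma dotDl u v w : dot (u + v) w = dot u w + dot v w.
Proof. by rewrite dotC dotDr !(dotC w). Qed.

Lemma dotZl a u v : dot (a *: u) v = a * dot u v.
Proof. by rewrite dotC dotZr dotC. Qed.

Lemma dotNl u v : dot (- u) v = - dot u v.
Proof. by rewrite dotC dotNr dotC. Qed.

Lemma dot0r u : dot u 0 = 0.
Proof. by rewrite dotE mulmx0 mxE. Qed.

Lemma dot_suml (I : finType) (A : {pred I}) (f : I -> 'cV[R]_p) v :
  dot (\sum_(i in A) f i) v = \sum_(i in A) dot (f i) v.
Proof.
by rewrite dotE raddf_sum mulmx_suml summxE; apply: eq_bigr => i _;
  rewrite dotE.
Qed.

Lemma dot_mulmx (A : 'M[R]_p) u v : dot u (A *m v) = dot (A^T *m u) v.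
Proof. by rewrite !dotE trmx_mul trmxK mulmxA. Qed.

Lemma dot_ge0 u : 0 <= dot u u.
Proof. by apply: sumr_ge0 => i _; rewrite -expr2 sqr_ge0. Qed.

Lemma dot_eq0 u : (dot u u == 0) = (u == 0).
Proof.
apply/eqP/eqP => [|->]; last exact: dot0r.
move/eqP; rewrite psumr_eq0 => [/allP u0|i _]; last by rewrite -expr2 sqr_ge0.
apply/colP => i; rewrite mxE; apply/eqP.
by have := u0 i (mem_index_enum i); rewrite /= -expr2 sqrf_eq0.
Qed.

Lemma norm2_ge0 u : 0 <= norm2 u.
Proof. exact: sqrtr_ge0. Qed.

Lemma sqr_norm2 u : norm2 u ^+ 2 = dot u u.
Proof. by rewrite sqr_sqrtr ?dot_ge0. Qed.

Lemma norm2_eq0 u : (norm2 u == 0) = (u == 0).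
Proof. by rewrite -sqrf_eq0 sqr_norm2 dot_eq0. Qed.

Lemma norm2Z a u : norm2 (a *: u) = `|a| * norm2 u.
Proof.
by rewrite /norm2 dotZl dotZr mulrA -expr2 sqrtrM ?sqr_ge0// sqrtr_sqr.
Qed.

Lemma norm2N u : norm2 (- u) = norm2 u.
Proof. by rewrite -scaleN1r norm2Z normrN1 mul1r. Qed.

(** A nonnegative quadratic has nonpositive discriminant: evaluate it at its
minimum -b/c, or far away along its slope if c = 0. *)
Lemma sqr_le_of_quadratic_ge0 (a b c : R) :
  0 <= c -> (forall t, 0 <= a + 2 * t * b + t ^+ 2 * c) -> b ^+ 2 <= a * c.
Proof.
move=> c_ge0 q_ge0; have a0 : 0 <= a by have := q_ge0 0; lra.
have [c0|c0|c0] := ltrgt0P c; last 2 first.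
- by move: c_ge0; rewrite leNgt c0.
- (* the affine function a + 2 t b equals - 1 at this t unless b = 0 *)
  have := q_ge0 (- (a + 1) / (2 * b)); rewrite c0.
  have [->|b0] := eqVneq b 0; first by lra.
  have -> : a + 2 * (- (a + 1) / (2 * b)) * b + (- (a + 1) / (2 * b)) ^+ 2 * 0
    = - 1.
    by field.
  lra.
- have := q_ge0 (- b / c); rewrite -(ler_pM2r c0) mul0r.
  have -> : (a + 2 * (- b / c) * b + (- b / c) ^+ 2 * c) * c = a * c - b ^+ 2.
    by field; rewrite gt_eqF.
  lra.
Qed.

(** Expand the form at u + t v and apply the discriminant criterion in t.  It
is needed for semidefinite forms as well as for the dot product. *)
Lemma Cauchy_Schwarz_form (A : 'M[R]_p) u v :
  A^T = A -> (forall w, 0 <= dot w (A *m w)) ->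
  dot u (A *m v) ^+ 2 <= dot u (A *m u) * dot v (A *m v).
Proof.
move=> symA A0; apply: sqr_le_of_quadratic_ge0 => // t.
have := A0 (u + t *: v).
rewrite mulmxDr -scalemxAr !(dotDl, dotDr, dotZl, dotZr).
rewrite (dot_mulmx A v u) symA (dotC _ u); lra.
Qed.

Lemma sqr_dot_le u v : dot u v ^+ 2 <= dot u u * dot v v.
Proof.
have := @Cauchy_Schwarz_form 1%:M u v; rewrite trmx1 !mul1mx; apply => // w.
by rewrite mul1mx dot_ge0.
Qed.

Lemma dot_le_norm2 u v : dot u v <= norm2 u * norm2 v.
Proof.
rewrite (le_trans (ler_norm _))// -ler_sqr ?nnegrE ?mulr_ge0 ?norm2_ge0//.
by rewrite real_normK ?num_real// exprMn !sqr_norm2 sqr_dot_le.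
Qed.

Lemma norm2D_le u v : norm2 (u + v) <= norm2 u + norm2 v.
Proof.
rewrite -ler_sqr ?nnegrE ?addr_ge0 ?norm2_ge0//.
rewrite sqr_norm2 dotDl !dotDr sqrrD !sqr_norm2 (dotC v u).
have := dot_le_norm2 u v; lra.
Qed.

Lemma norm2_coord u i : `|u i 0| <= norm2 u.
Proof.
rewrite -ler_sqr ?nnegrE ?norm2_ge0// real_normK ?num_real// sqr_norm2.
rewrite /dot (bigD1 i)//= expr2 lerDl; apply: sumr_ge0 => j _.
by rewrite -expr2 sqr_ge0.
Qed.

(** Cauchy-Schwarz against the all-ones vector. *)
Lemma sum_abs_le_norm2 u : \sum_i `|u i 0| <= Num.sqrt p%:R * norm2 u.
Proof.
pose a : 'cV[R]_p := \col_i `|u i 0|.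
have -> : \sum_i `|u i 0| = dot (const_mx 1) a.
  by apply: eq_bigr => i _; rewrite !mxE mul1r.
apply: le_trans (dot_le_norm2 _ _) _.
have -> : norm2 a = norm2 u.
  congr Num.sqrt; apply: eq_bigr => i _.
  by rewrite !mxE -!expr2 real_normK ?num_real.
rewrite /norm2 /dot; under eq_bigr do rewrite !mxE mul1r.
by rewrite sumr_const card_ord.
Qed.

End euclidean_space.

(** * Rayleigh quotients and weak stability *)

Section rayleigh.
Variables (R : realType) (p : nat).
Implicit Types (A : 'M[R]_p) (u v : 'cV[R]_p).

(** A crude operator-norm bound; it makes the Rayleigh quotients bounded, and
it serves for an inverse matrix as well. *)
Lemma form_le_entries A v :
  `|dot v (A *m v)| <= (\sum_i \sum_j `|A i j|) * dot v v.
Proof.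
apply: le_trans (ler_norm_sum _ _ _) _; rewrite mulr_suml;
  apply: ler_sum => i _.
rewrite mxE mulr_sumr mulr_suml; apply: le_trans (ler_norm_sum _ _ _) _.
apply: ler_sum => j _; rewrite !normrM mulrCA -sqr_norm2 expr2.
by rewrite ler_wpM2l// ler_pM ?norm2_coord.
Qed.

(** Let mu be the infimum of the Rayleigh quotient and B = A - mu, a
nonnegative form.  If B were invertible, Cauchy-Schwarz for B applied to B^-1 v
and v would give |v|^4 <= <v, B^-1 v> <v, B v>, hence <v, B v> >= |v|^2 / K
with K a bound on the form B^-1, and mu would not be the infimum. *)
Lemma symmetric_min_eigenvalue A : (0 < p)%N -> A^T = A ->
  exists mu, eigenvalue A mu /\ forall v, mu * dot v v <= dot v (A *m v).
Proof.
move=> p0 symA.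
pose E := [set dot v (A *m v) | v in [set v | dot v v = 1]].
have E_lb : has_lbound E.
  exists (- \sum_i \sum_j `|A i j|) => _ [v /= v1 <-].
  by have := form_le_entries A v; rewrite v1 mulr1 ler_norml => /andP[].
have E0 : E !=set0.
  pose e : 'cV[R]_p := \col_i (i == Ordinal p0)%:R.
  exists (dot e (A *m e)); exists e => //=.
  rewrite /dot (bigD1 (Ordinal p0))//= !mxE eqxx mulr1 big1 ?addr0// => i
    /negbTE i0.
  by rewrite !mxE i0 mul0r.
pose mu := inf E.
have form_ge v : mu * dot v v <= dot v (A *m v).
  have [->|v0] := eqVneq v 0; first by rewrite mulmx0 !dot0r mulr0.
  have n0 : 0 < norm2 v by rewrite lt_neqAle norm2_ge0 eq_sym norm2_eq0 v0.
  have : mu <= dot ((norm2 v)^-1 *: v) (A *m ((norm2 v)^-1 *: v)).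
    apply: ge_inf => //; exists ((norm2 v)^-1 *: v) => //=.
    by rewrite dotZl dotZr -sqr_norm2; field; rewrite gt_eqF.
  rewrite -scalemxAr dotZl dotZr -(ler_pM2r (_ : 0 < dot v v)); last first.
    by rewrite -sqr_norm2 exprn_gt0.
  move=> /le_trans; apply; rewrite -sqr_norm2 le_eqVlt; apply/orP; left.
  by apply/eqP; field; rewrite gt_eqF.
exists mu; split => //.
have [//|not_eig] := boolP (eigenvalue A mu).
pose B := A - mu%:M.
have uB : B \in unitmx.
  rewrite -row_free_unit -kermx_eq0; move: not_eig.
  by rewrite /eigenvalue /eigenspace negbK.
have symB : B^T = B by rewrite /B raddfB/= symA tr_scalar_mx.
have BE v : dot v (B *m v) = dot v (A *m v) - mu * dot v v.
  by rewrite mulmxBl dotBr mul_scalar_mx dotZr.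
have B0 v : 0 <= dot v (B *m v) by rewrite BE subr_ge0.
pose K := \sum_i \sum_j `|invmx B i j| + 1.
have K0 : 0 < K.
  by rewrite ltr_wpDl// sumr_ge0// => i _; rewrite sumr_ge0.
suff : mu + K^-1 <= mu by rewrite gerDl leNgt invr_gt0 K0.
apply: lb_le_inf => // _ [v /= v1 <-].
have := Cauchy_Schwarz_form (invmx B *m v) v symB B0.
rewrite {1}dot_mulmx symB !mulmxA (mulmxV uB) !mul1mx v1 expr1n.
have := form_le_entries (invmx B) v; rewrite v1 mulr1 (dotC (_ *m v) v).
move=> /(le_trans (ler_norm _)) inv_le; rewrite BE v1 mulr1 => one_le.
rewrite addrC -lerBrDr; set q := (X in X <= _ - _); rewrite -/mu.
have q0 : 0 <= dot v (A *m v) - mu by have := B0 v; rewrite BE v1 mulr1.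
rewrite /q -(ler_pM2l K0) divff ?gt_eqF//.
apply: (le_trans one_le); apply: ler_wpM2r => //.
by apply: (le_trans inv_le); rewrite lerDl.
Qed.

(** Evaluate the form at an eigenvector. *)
Lemma form_lower_bound_le_eigenvalue A (mu a : R) : A^T = A ->
  (forall v, mu * dot v v <= dot v (A *m v)) -> eigenvalue A a -> mu <= a.
Proof.
move=> symA form_ge /eigenvalueP[w wA w0].
have v0 : 0 < dot w^T w^T.
  by rewrite lt_neqAle dot_ge0 andbT eq_sym dot_eq0 trmx_eq0.
have := form_ge w^T; rewrite -[X in X *m _]symA -trmx_mul wA.
by rewrite linearZ/= dotZr ler_pM2r.
Qed.

Lemma lambda_min_form A v : (0 < p)%N -> A^T = A ->
  lambda_min A * dot v v <= dot v (A *m v).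
Proof.
move=> p0 symA; have [mu [mu_eig mu_le]] := symmetric_min_eigenvalue p0 symA.
apply: le_trans (mu_le v); apply: ler_wpM2r; first exact: dot_ge0.
apply: ge_inf => //; exists mu => a; exact: form_lower_bound_le_eigenvalue.
Qed.

(** Apply [symmetric_min_eigenvalue] to - A. *)
Lemma lambda_max_form A v : (0 < p)%N -> A^T = A ->
  dot v (A *m v) <= lambda_max A * dot v v.
Proof.
move=> p0 symA; have symNA : (- A)^T = - A by rewrite raddfN/= symA.
have [mu [mu_eig mu_le]] := symmetric_min_eigenvalue p0 symNA.
have opp_eig (B : 'M[R]_p) a : eigenvalue B a -> eigenvalue (- B) (- a).
  move=> /eigenvalueP[w wB w0]; apply/eigenvalueP; exists w => //.
  by rewrite mulmxN wB scaleNr.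
have le_sup : - mu <= lambda_max A.
  apply: ub_le_sup; last by rewrite /= -[A]opprK; exact: opp_eig.
  exists (- mu) => a /= /opp_eig a_eig; rewrite lerNr.
  exact: form_lower_bound_le_eigenvalue a_eig.
have := mu_le v; rewrite mulNmx dotNr.
have := ler_wpM2r (dot_ge0 v) le_sup; lra.
Qed.

End rayleigh.

Section weak_stability.
Variables (R : realType) (n p : nat) (x : 'I_n -> 'cV[R]_p).

Lemma second_moment_sym (S : {set 'I_n}) :
  (second_moment x S)^T = second_moment x S.
Proof.
rewrite /second_moment linearZ/= raddf_sum; congr (_ *: _).
by apply: eq_bigr => i _; rewrite /= trmx_mul trmxK.
Qed.

Lemma second_moment_form (S : {set 'I_n}) (v : 'cV[R]_p) :
  dot v (second_moment x S *m v) = n%:R^-1 * \sum_(i in S) dot (x i) v ^+ 2.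
Proof.
rewrite -scalemxAl dotZr mulmx_suml dotC dot_suml; congr (_ * _).
apply: eq_bigr => i _; rewrite dotC -mulmxA dotE mulmxA mxE big_ord1.
by rewrite -!dotE (dotC v) expr2.
Qed.

(** In dimension 0 the spectrum is empty, so [lambda_min] is 0 and cannot be at
least L > 0. *)
Lemma weak_stability_dim (eps L U : R) : 0 < eps -> 0 < L ->
  weak_stability eps L U x -> (0 < p)%N.
Proof.
move=> eps0 L0 ws; rewrite lt0n; apply/eqP => p_eq0.
have card_all : (1 - eps) * n%:R <= #|[set: 'I_n]%SET|%:R.
  by rewrite cardsT card_ord ler_piMl//; lra.
have [+ _ _] := ws _ card_all.
rewrite /lambda_min (_ : [set a | _] = set0) ?inf0 ?leNgt ?L0//.
rewrite -subset0 => a /= /eigenvalueP[w _ /negP]; apply.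
by apply/eqP/rowP => -[i ip]; exfalso; move: ip; rewrite p_eq0.
Qed.

Lemma weak_stability_form (eps L U : R) (S : {set 'I_n}) (v : 'cV[R]_p) :
  0 < eps -> 0 < L -> weak_stability eps L U x ->
  (1 - eps) * n%:R <= #|S|%:R ->
  L * dot v v <= n%:R^-1 * \sum_(i in S) dot (x i) v ^+ 2 <= U * dot v v.
Proof.
move=> eps0 L0 ws cardS; have p0 := weak_stability_dim eps0 L0 ws.
have [L_le _ le_U] := ws S cardS; rewrite -second_moment_form.
have symS := second_moment_sym S; apply/andP; split.
  apply: le_trans (lambda_min_form v p0 symS).
  by apply: ler_wpM2r => //; exact: dot_ge0.
apply: le_trans (lambda_max_form v p0 symS) _.
by apply: ler_wpM2r => //; exact: dot_ge0.
Qed.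

End weak_stability.

(** * The Huber loss and its derivative *)

Section huber_loss.
Variables (R : realType) (gamma : R).
Implicit Types s t : R.

Definition clip t : R := Num.max (- gamma) (Num.min gamma t).

Variant huber_region t : R -> R -> Prop :=
| HuberQuadratic of - gamma <= t & t <= gamma : huber_region t (t ^+ 2 / 2) t
| HuberRight of gamma < t :
    huber_region t (gamma * t - gamma ^+ 2 / 2) gamma
| HuberLeft of t < - gamma :
    huber_region t (gamma * - t - gamma ^+ 2 / 2) (- gamma).

Lemma huberP t : 0 < gamma -> huber_region t (huber gamma t) (clip t).
Proof.
move=> gamma0; rewrite /huber /clip ler_norml.
have gN : - gamma <= gamma by lra.
have [t_left|t1] := ltrP t (- gamma).
  have t0 : t < 0 by lra.
  have tg : t <= gamma by lra.
  rewrite /= min_r// (max_l (ltW t_left)) ltr0_norm//; exact: HuberLeft.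
have [t_right|t2] := ltrP gamma t.
  have t0 : 0 < t by lra.
  rewrite /= max_r// gtr0_norm//; exact: HuberRight.
by rewrite /= max_r//; exact: HuberQuadratic.
Qed.

(** The derivative [clip] is nondecreasing and 1-Lipschitz, so the error of the
first-order expansion lies between 0 and half the squared increment. *)
Lemma huber_tangent s t : 0 < gamma ->
  huber gamma s + clip s * (t - s) <= huber gamma t
  <= huber gamma s + clip s * (t - s) + (t - s) ^+ 2 / 2.
Proof.
move=> gamma0; apply/andP; split; case: (huberP s gamma0) => *;
  case: (huberP t gamma0) => *.
all: have := sqr_ge0 (t - s); nra.
Qed.

Lemma huber_quadratic s t : 0 < gamma -> `|s| <= gamma -> `|t| <= gamma ->
  huber gamma t = huber gamma s + clip s * (t - s) + (t - s) ^+ 2 / 2.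
Proof.
move=> gamma0; rewrite !ler_norml; case: (huberP s gamma0) => *;
  case: (huberP t gamma0) => *; nra.
Qed.

Lemma clipN t : 0 < gamma -> clip (- t) = - clip t.
Proof.
move=> gamma0; case: (huberP t gamma0) => *; case: (huberP (- t) gamma0) => *;
  lra.
Qed.

Lemma clip_le t : 0 < gamma -> `|clip t| <= gamma.
Proof. by move=> gamma0; rewrite ler_norml; case: (huberP t gamma0) => *;
  lra. Qed.

Lemma clip_continuous : continuous clip.
Proof.
move=> t; apply: (@continuous_max _ _ (cst (- gamma)) (Num.min gamma)).
  exact: cvg_cst.
by apply: (@continuous_min _ _ (cst gamma) id); [exact: cvg_cst|exact: cvg_id].
Qed.

Lemma measurable_clip : measurable_fun [set: R] clip.
Proof.
apply: continuous_measurable_fun; exact: clip_continuous.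
Qed.

End huber_loss.

Lemma continuous_sum_fun (R : realType) (V W : normedModType R) (I : Type)
    (r : seq I) (F : I -> V -> W) :
  (forall i, continuous (F i)) -> continuous (fun v => \sum_(i <- r) F i v).
Proof.
move=> cF; elim: r => [|i r IHr].
  by under eq_fun do rewrite big_nil; exact: cst_continuous.
by under eq_fun do rewrite big_cons; move=> v; apply: cvgD;
  [exact: cF|exact: IHr].
Qed.

Section quadratic_remainder.
Variables (R : realType) (p : nat).
Implicit Types (b g v : 'cV[R]_p) (f : 'cV[R]_p -> R).

(** An alias of [dot g] that can carry the structure of a linear map. *)
Definition dot_fun g : 'cV[R]_p -> R := dot g.

Fact dot_fun_linear g : linear (dot_fun g).
Proof. by move=> a u v; rewrite /dot_fun dotDr dotZr. Qed.

HB.instance Definition _ g :=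
  GRing.isLinear.Build R 'cV[R]_p R *:%R (dot_fun g) (dot_fun_linear g).

Lemma dot_continuous g : continuous (dot g).
Proof.
apply: (@continuous_sum_fun _ _ R^o _ _ (fun i v => g i 0 * v i 0)) => i v.
apply: (@continuousM _ _ (cst (g i 0)) (fun v : 'cV[R]_p => v i 0)).
  exact: cst_continuous.
exact: coord_continuous.
Qed.

Lemma dot_le_mx_norm v : dot v v <= p%:R * `|v| ^+ 2.
Proof.
rewrite /dot -[p in p%:R]card_ord -sumr_const mulr_suml; apply: ler_sum => i _.
rewrite mul1r -expr2 -real_normK ?num_real// lerXn2r ?nnegrE//.
change `|v| with (mx_norm v); rewrite mx_normrE.
exact: (le_bigmax 0 (fun ij : 'I_p * 'I_1 => `|v ij.1 ij.2|) (i, 0)).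
Qed.

(** A quadratic remainder is a little-o of the increment; the sup norm of the
topology and the Euclidean norm differ by a factor depending on p only. *)
Lemma differentiable_quadratic_remainder f b g (K : R) :
  (forall v, `|f (b + v) - f b - dot g v| <= K * dot v v) ->
  differentiable f b /\ gradient f b = g.
Proof.
move=> remainder.
have expansion : f \o shift b = cst (f b) + dot_fun g +o_ (nbhs (0 : 'cV[R]_p))
  id.
  apply/eqaddoP => _/posnumP[e].
  pose M := `|K| * p%:R + 1.
  have M0 : 0 < M by rewrite ltr_wpDl// mulr_ge0.
  have v_small : \forall v \near (0 : 'cV[R]_p), `|v| <= e%:num / M.
    by apply: nbhs0_le; exact: divr_gt0.
  apply: (filterS _ v_small) => v vM.
  rewrite -[X in `|X|]/(f (v + b) - (f b + dot g v)) (addrC v) opprD addrA.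
  apply: le_trans (remainder v) _.
  apply: le_trans (ler_wpM2r (dot_ge0 v) (ler_norm K)) _.
  apply: le_trans (ler_wpM2l (normr_ge0 K) (dot_le_mx_norm v)) _.
  rewrite mulrA expr2 mulrA ler_wpM2r//.
  apply: (@le_trans _ _ (M * `|v|)); first by rewrite ler_wpM2r// lerDl.
  by rewrite mulrC -ler_pdivlMr.
pose dg : {linear 'cV[R]_p -> R} := dot_fun g.
have dE : 'd f b = dot g :> ('cV[R]_p -> R).
  exact: (@diff_unique _ _ _ f dg b (@dot_continuous g) expansion).
have df : differentiable f b.
  by apply/diff_locallyP; rewrite dE; split; first exact: dot_continuous.
split => //; apply/colP => i; rewrite mxE deriveE// dE /dot.
rewrite (bigD1 i)//= big1 ?addr0 ?mxE ?eqxx ?mulr1// => j /negbTE ji.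
by rewrite !mxE ji mulr0.
Qed.
End quadratic_remainder.

(** * The empirical objective *)

Section huber_objective.
Variables (R : realType) (n p : nat) (gamma : R).
Variables (x : 'I_n -> 'cV[R]_p) (y : 'I_n -> R).
Implicit Types (b v : 'cV[R]_p) (S : {set 'I_n}).

Local Notation loss := (huber_objective gamma x y).

Definition huber_gradient b : 'cV[R]_p :=
  - n%:R^-1 *: \sum_(i < n) clip gamma (y i - dot (x i) b) *: x i.

Lemma dot_huber_gradient b v : dot (huber_gradient b) v =
  n%:R^-1 * \sum_(i < n) clip gamma (y i - dot (x i) b) * - dot (x i) v.
Proof.
rewrite /huber_gradient dotZl mulNr -mulrN dot_suml -sumrN; congr (_ * _).
by apply: eq_bigr => i _; rewrite dotZl mulrN.
Qed.

Lemma residual_step b v (i : 'I_n) :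
  (y i - dot (x i) (b + v)) - (y i - dot (x i) b) = - dot (x i) v.
Proof. by rewrite dotDr; ring. Qed.

(** Sum the first-order expansions of the individual losses. *)
Lemma huber_objective_tangent b v : 0 < gamma ->
  loss b + dot (huber_gradient b) v <= loss (b + v) <=
  loss b + dot (huber_gradient b) v
    + (n%:R^-1 * \sum_(i < n) dot (x i) v ^+ 2) / 2.
Proof.
move=> gamma0; rewrite dot_huber_gradient /huber_objective -mulrDr -big_split.
rewrite -mulrA -mulrDr mulr_suml -big_split !ler_wpM2l ?invr_ge0//=;
  apply: ler_sum => i _;
  have := huber_tangent (y i - dot (x i) b) (y i - dot (x i) (b + v)) gamma0;
  by rewrite residual_step sqrrN => /andP[].
Qed.

(** Only indices at which both residuals lie in the quadratic region contribute
to the curvature; the other losses are bounded below by their tangents. *)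
Lemma huber_objective_curvature b v S : 0 < gamma ->
  (forall i, i \in S -> `|y i - dot (x i) b| <= gamma /\
                        `|y i - dot (x i) (b + v)| <= gamma) ->
  loss b + dot (huber_gradient b) v
    + (n%:R^-1 * \sum_(i in S) dot (x i) v ^+ 2) / 2 <= loss (b + v).
Proof.
move=> gamma0 S_quad; rewrite dot_huber_gradient /huber_objective.
rewrite -mulrDr -big_split -mulrA -mulrDr mulr_suml [X in _ + X]big_mkcond.
rewrite -big_split ler_wpM2l ?invr_ge0//=; apply: ler_sum => i _.
have step := residual_step b v i.
case: ifPn => [/S_quad[quad0 quad1]|_].
  by rewrite (huber_quadratic gamma0 quad0 quad1) step sqrrN.
rewrite addr0.
have := huber_tangent (y i - dot (x i) b) (y i - dot (x i) (b + v)) gamma0.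
by rewrite step => /andP[].
Qed.

Lemma differentiable_huber_objective b : 0 < gamma ->
  differentiable loss b /\ gradient loss b = huber_gradient b.
Proof.
move=> gamma0.
apply: (@differentiable_quadratic_remainder _ _ _ _ _
  ((n%:R^-1 * \sum_(i < n) dot (x i) (x i)) / 2)) => v.
have /andP[lower upper] := huber_objective_tangent b v gamma0.
rewrite ger0_norm; last by lra.
have : (n%:R^-1 * \sum_(i < n) dot (x i) v ^+ 2) / 2 <=
    (n%:R^-1 * \sum_(i < n) dot (x i) (x i)) / 2 * dot v v.
  rewrite [leRHS]mulrAC ler_pM2r// -mulrA ler_wpM2l ?invr_ge0//.
  by rewrite mulr_suml; apply: ler_sum => i _; exact: sqr_dot_le.
lra.
Qed.

Lemma continuous_huber_gradient : continuous huber_gradient.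
Proof.
have clip_cont i : continuous (fun b => clip gamma (y i - dot (x i) b)).
  move=> b; apply: (@continuous_comp 'cV[R]_p R R
    (fun b => y i - dot (x i) b) (clip gamma)).
    apply: (@continuousB _ _ _ (cst (y i)) (dot (x i)));
      first exact: cst_continuous.
    exact: dot_continuous.
  exact: clip_continuous.
have sum_cont : continuous (fun b : 'cV[R]_p =>
    \sum_(i < n) clip gamma (y i - dot (x i) b) *: x i).
  apply: continuous_sum_fun => i b.
  exact: (@continuousZr_tmp _ _ _ _ (x i) _ (clip_cont i b)).
by move=> b; apply: (@continuousZl_tmp _ _ _ _ (- n%:R^-1)); exact: sum_cont.
Qed.

(** Average the tangent inequalities from the intermediate point to both ends.
*)
Lemma huber_objective_convex b v t : 0 < gamma -> 0 <= t <= 1 ->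
  loss (b + t *: v) <= (1 - t) * loss b + t * loss (b + v).
Proof.
move=> gamma0 /andP[t0 t1].
have /andP[at0 _] := huber_objective_tangent (b + t *: v) (- (t *: v)) gamma0.
have /andP[at1 _] := huber_objective_tangent (b + t *: v) ((1 - t) *: v) gamma0.
move: at0 at1; rewrite addrK -addrA -scalerDl [t + _]addrC subrK scale1r.
rewrite dotNr !dotZr; set D := dot _ v => at0 at1.
have : (1 - t) * (loss (b + t *: v) - t * D) <= (1 - t) * loss b.
  by rewrite ler_wpM2l// subr_ge0.
have : t * (loss (b + t *: v) + (1 - t) * D) <= t * loss (b + v).
  exact: ler_wpM2l.
lra.
Qed.

End huber_objective.

(** * Geometry of the objective near the true parameter *)

Section local_geometry.
Variables (R : realType) (n p : nat) (eps L U gamma : R).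
Variables (x : 'I_n -> 'cV[R]_p) (y : 'I_n -> R) (betastar : 'cV[R]_p).
Implicit Types (b v : 'cV[R]_p).
Hypotheses (eps01 : 0 < eps < 1) (L0 : 0 < L) (U0 : 0 < U) (gamma0 : 0 < gamma).
Hypotheses (n0 : (0 < n)%N) (stable : weak_stability eps L U x).

Local Notation z i := (y i - dot (x i) betastar).
Local Notation loss := (huber_objective gamma x y).
Local Notation radius := (eps * gamma / Num.sqrt U / 4).

Hypothesis few_outliers :
  #|[set i | gamma / 2 <= `|z i|]%SET|%:R <= eps / 2 * n%:R.

(** Chebyshev counting: each index counted contributes at least a^2 to the sum
of the squared projections, which weak stability for the full sample bounds. *)
Lemma card_leverage_le v (a : R) : 0 < a ->
  #|[set i | a < `|dot (x i) v|]%SET|%:R * a ^+ 2 <= n%:R * (U * dot v v).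
Proof.
move=> a0; have [eps0 _] := andP eps01.
have nR0 : 0 < n%:R :> R by rewrite ltr0n.
have card_all : (1 - eps) * n%:R <= #|[set: 'I_n]%SET|%:R.
  rewrite cardsT card_ord ler_piMl//; lra.
have /andP[_] := weak_stability_form v eps0 L0 stable card_all.
rewrite -(ler_pM2l nR0) mulVKf ?gt_eqF//; apply: le_trans.
rewrite -sum1_card natr_sum mulr_suml.
rewrite [leLHS]big_mkcond [leRHS]big_mkcond; apply: ler_sum => i _;
  rewrite !inE.
case: ifPn => [/ltW a_le|_]; last exact: sqr_ge0.
by rewrite mul1r -[leRHS]real_normK ?num_real// lerXn2r// nnegrE ltW.
Qed.

(** With the radius chosen, the counting bound is eps^2 n / 4. *)
Lemma card_far_le v : norm2 v <= radius ->
  #|[set i | gamma / 2 < `|dot (x i) v|]%SET|%:R <= eps / 4 * n%:R.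
Proof.
move=> v_le; have /andP[eps0 eps1] := eps01.
have a0 : 0 < gamma / 2 by exact: divr_gt0.
have := card_leverage_le v a0; set k := _%:R.
have sU0 : 0 < Num.sqrt U by rewrite sqrtr_gt0.
have v2 : U * dot v v <= (eps * gamma) ^+ 2 / 16.
  rewrite -sqr_norm2 -[U](sqr_sqrtr (ltW U0)) -exprMn.
  have -> : (eps * gamma) ^+ 2 / 16 = (Num.sqrt U * radius) ^+ 2.
    by field; rewrite gt_eqF.
  have radius0 : 0 <= radius.
    by rewrite !divr_ge0 ?sqrtr_ge0// mulr_ge0// ltW.
  by rewrite lerXn2r ?nnegrE ?ler_wpM2l ?sqrtr_ge0// mulr_ge0 ?sqrtr_ge0
    ?norm2_ge0.
move=> /le_trans/(_ (ler_wpM2l (ler0n R n) v2)).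
rewrite [(eps * gamma) ^+ 2]exprMn => k_le.
have : k * (gamma / 2) ^+ 2 <= (eps / 4 * n%:R) * (gamma / 2) ^+ 2.
  apply: (le_trans k_le).
  have -> : eps / 4 * n%:R * (gamma / 2) ^+ 2 = n%:R * (eps * gamma ^+ 2 / 16).
    by field.
  rewrite ler_wpM2l// ler_pM2r// ler_wpM2r ?sqr_ge0// expr2 ler_piMl ?ltW//.
by rewrite ler_pM2r// exprn_gt0.
Qed.

(** An excluded index has a large error (at most eps n / 2 of them) or a large
shift for one of the two points (at most eps n / 4 for each). *)
Lemma card_inliers_ge v v' : norm2 v <= radius -> norm2 v' <= radius ->
  (1 - eps) * n%:R <= #|[set i | [&& `|z i| < gamma / 2,
    `|dot (x i) v| <= gamma / 2 & `|dot (x i) v'| <= gamma / 2]]%SET|%:R.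
Proof.
move=> /card_far_le far /card_far_le far'; set S := [set i | _]%SET.
have cover : ~: S \subset ([set i | gamma / 2 <= `|z i|]
    :|: [set i | gamma / 2 < `|dot (x i) v|]
    :|: [set i | gamma / 2 < `|dot (x i) v'|])%SET.
  by apply/fintype.subsetP => i; rewrite !inE !negb_and -leNgt -!ltNge orbA.
have := leq_trans (subset_leq_card cover) (leq_card_setU _ _).
move=> /leq_trans/(_ (leq_add (leq_card_setU _ _) (leqnn _))).
rewrite -(leq_add2l #|S|) cardsC card_ord -(ler_nat R) !natrD.
move: few_outliers far far'; lra.
Qed.

(** On the inliers common to b and b' both residuals are at most gamma, so the
loss is quadratic there, and these indices are numerous enough for weak
stability to bound the curvature below by L. *)
Lemma huber_objective_locally_strongly_convex b b' :
  norm2 (b - betastar) <= radius -> norm2 (b' - betastar) <= radius ->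
  loss b + dot (huber_gradient gamma x y b) (b' - b)
    + L / 2 * norm2 (b' - b) ^+ 2 <= loss b'.
Proof.
move=> b_near b'_near; have /andP[eps0 _] := eps01.
have S_large := card_inliers_ge b_near b'_near.
set S := [set i | _]%SET in S_large.
have res_le c i : `|z i| < gamma / 2 -> `|dot (x i) (c - betastar)| <= gamma /
  2 ->
    `|y i - dot (x i) c| <= gamma.
  move=> z_lt /(lerD (ltW z_lt)); rewrite -splitr; apply: le_trans.
  rewrite dotBr; set d := dot _ c - _.
  have -> : y i - dot (x i) c = z i - d by rewrite /d; ring.
  exact: ler_normB.
have b'E : b + (b' - b) = b' by rewrite addrC subrK.
have S_quad i : i \in S -> `|y i - dot (x i) b| <= gamma /\
    `|y i - dot (x i) (b + (b' - b))| <= gamma.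
  by rewrite b'E inE => /and3P[z_lt bi b'i]; split; exact: res_le.
have := huber_objective_curvature gamma0 S_quad; rewrite b'E; apply: le_trans.
rewrite lerD2l sqr_norm2 mulrAC ler_pM2r//.
by have /andP[+ _] := weak_stability_form (b' - b) eps0 L0 stable S_large.
Qed.

(** Inside the ball, strong convexity at the true parameter gives L |v|^2 / 2
<= kappa |v|.  If the minimizer were outside, the point of its segment to the
true parameter at distance exactly [radius] would have, by convexity, a loss
not exceeding that of the true parameter, so the same bound would give radius
<= 2 kappa / L. *)
Lemma minimizer_error betahat (kappa : R) : argmin loss betahat ->
  norm2 (huber_gradient gamma x y betastar) <= kappa ->
  2 * kappa / L < radius ->
  norm2 (betahat - betastar) <= 2 * kappa / L.
Proof.
move=> bmin grad_le kappa_lt; set v := betahat - betastar.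
have bE : betastar + v = betahat by rewrite addrC subrK.
have kappa0 : 0 <= kappa by rewrite (le_trans (norm2_ge0 _) grad_le).
have err0 : 0 <= 2 * kappa / L by rewrite divr_ge0 ?(ltW L0)// mulr_ge0.
have radius0 : 0 < radius by exact: le_lt_trans kappa_lt.
(* The bound must also apply to the point of the segment on the sphere, which
   is not a minimizer: hence the weaker assumption on w. *)
have near_le w : norm2 w <= radius -> loss (betastar + w) <= loss betastar ->
    norm2 w <= 2 * kappa / L.
  move=> w_le loss_le.
  have := @huber_objective_locally_strongly_convex betastar (betastar + w).
  have -> : betastar + w - betastar = w by rewrite addrAC subrr add0r.
  have -> : norm2 (betastar - betastar) = 0 by apply/eqP;
    rewrite norm2_eq0 subrr.
  move=> /(_ (ltW radius0) w_le).
  have := dot_le_norm2 (- huber_gradient gamma x y betastar) w.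
  rewrite dotNl norm2N; have := ler_wpM2r (norm2_ge0 w) grad_le.
  have [->|w0] := eqVneq (norm2 w) 0; first by [].
  have {}w0 : 0 < norm2 w by rewrite lt_neqAle eq_sym w0 norm2_ge0.
  move=> h1 h2 h3; rewrite ler_pdivlMr// -(ler_pM2r w0).
  move: loss_le h1 h2 h3; rewrite expr2; lra.
have [v_near|v_far] := lerP (norm2 v) radius.
  by apply: near_le => //; rewrite bE; exact: bmin.
have v0 : 0 < norm2 v by exact: lt_trans v_far.
pose t := radius / norm2 v.
have t01 : 0 <= t <= 1.
  rewrite (ler_pdivrMr _ _ v0) mul1r (ltW v_far) andbT.
  by rewrite divr_ge0// ltW.
have tv : norm2 (t *: v) = radius.
  rewrite norm2Z ger0_norm; last by case/andP: t01.
  by rewrite /t divfK// gt_eqF.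
suff loss_le : loss (betastar + t *: v) <= loss betastar.
  have := near_le (t *: v); rewrite tv lexx => /(_ isT loss_le).
  by rewrite leNgt kappa_lt.
apply: le_trans (huber_objective_convex x y betastar v gamma0 t01) _.
rewrite bE; have := ler_wpM2l (proj1 (andP t01)) (bmin betastar); lra.
Qed.

End local_geometry.

(** * Expectations of products of independent variables *)

Section product_expectation.
Context d (T : measurableType d) (R : realType) (P : probability T R).
Import HBNNSimple.

(** Two weights that give the same integral to every event in terms of X give
the same integral to every nonnegative function of X: both sides are limits of
the same combinations of integrals against indicators. *)
Lemma ge0_integral_mul_comp_eq d' (Y : measurableType d')
    (F G : T -> R) (X : {RV P >-> Y}) (g : Y -> R) :
  (forall w, 0 <= F w) -> measurable_fun setT F ->
  (forall w, 0 <= G w) -> measurable_fun setT G ->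
  (forall r, 0 <= g r) -> measurable_fun setT g ->
  (forall B : set Y, measurable B ->
    \int[P]_w (F w * \1_B (X w))%:E = \int[P]_w (G w * \1_B (X w))%:E)%E ->
  (\int[P]_w (F w * g (X w))%:E = \int[P]_w (G w * g (X w))%:E)%E.
Proof.
move=> F0 mF G0 mG g0 mg FG.
have mge : measurable_fun setT (EFin \o g).
  exact/measurable_EFinP.
pose h := nnsfun_approx measurableT mge.
have mX : measurable_fun setT X by [].
have mhX n : measurable_fun setT (fun w => h n (X w)).
  exact: (@measurableT_comp _ _ _ _ _ _ (h n)).
have mB n k : measurable (h n @^-1` [set k]) by [].
suff lim_simple (H : T -> R) :
    (forall w, 0 <= H w) -> measurable_fun setT H ->
    (\int[P]_w (H w * g (X w))%:E = limn (fun n => \sum_(k \in range (h n))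
      k%:E * \int[P]_w (H w * (\1_(h n @^-1` [set k]) (X w)))%:E))%E.
  rewrite !lim_simple//; congr (limn _); apply/funext => n.
  by apply: eq_fsbigr => k _; rewrite FG.
move=> {F0 mF G0 mG FG F G} H0 mH.
have m1 n k : measurable_fun setT (fun w => H w * \1_(h n @^-1` [set k]) (X w)).
  apply: measurable_funM => //.
  apply: (@measurableT_comp _ _ _ _ _ _ (\1_(h n @^-1` [set k]) : Y -> R)) =>
    //.
transitivity (\int[P]_w limn (fun n => (H w * h n (X w))%:E))%E.
  apply: eq_integral => w _; apply/esym/cvg_lim => //.
  under eq_fun do rewrite EFinM.
  rewrite EFinM; apply: cvgeZl => //.
  apply: (@cvg_nnsfun_approx _ _ _ _ measurableT _ mge) => // y _.
  by rewrite lee_fin.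
rewrite monotone_convergence//; last 3 first.
- by move=> n; apply/measurable_EFinP/measurable_funM.
- by move=> n w _; rewrite lee_fin mulr_ge0.
- move=> w _ m n mn; rewrite lee_fin ler_wpM2l//.
  exact/lefP/nd_nnsfun_approx.
congr (limn _); apply/funext => n /=.
transitivity (\int[P]_w (\sum_(k \in range (h n))
    (k%:E * (H w * \1_(h n @^-1` [set k]) (X w))%:E)))%E.
  apply: eq_integral => w _.
  rewrite fimfunE mulr_fsumr -fsumEFin//.
  by apply: eq_fsbigr => k _; rewrite -EFinM mulrCA.
rewrite ge0_integral_fsum//; last 2 first.
- by move=> k; apply/measurable_funeM/measurable_EFinP.
- move=> k w _; rewrite EFinM muleCA mule_ge0 ?lee_fin//.
  exact: nnfun_muleindic_ge0.
apply: eq_fsbigr => k; rewrite inE => -[r _ <-].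
rewrite ge0_integralZl//; first exact/measurable_EFinP.
by move=> w _; rewrite lee_fin mulr_ge0.
by rewrite lee_fin.
Qed.

(** The functions are replaced by general ones one index at a time, starting
from indicators, for which the claim is the definition of independence.  The
step at index i compares the weight given by the other factors with a constant
weight. *)
Lemma ge0_integral_prod_indep (I : finType) (X : I -> {RV P >-> R})
    (g : I -> R -> R) :
  mutually_independent X ->
  (forall i r, 0 <= g i r) -> (forall i, measurable_fun [set: R] (g i)) ->
  (forall i, \int[P]_w (g i (X i w))%:E < +oo)%E ->
  (\int[P]_w (\prod_i g i (X i w))%:E =
   \prod_i \int[P]_w (g i (X i w))%:E)%E.
Proof.
move=> indX.
have mX i : measurable_fun setT (X i) by [].
suff claim (s : seq I) : forall g : I -> R -> R,
    (forall i r, 0 <= g i r) -> (forall i, measurable_fun [set: R] (g i)) ->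
    (forall i, \int[P]_w (g i (X i w))%:E < +oo)%E ->
    (forall i, i \notin s -> exists2 B : set R, measurable B & g i = \1_B) ->
    (\int[P]_w (\prod_i g i (X i w))%:E =
     \prod_i \int[P]_w (g i (X i w))%:E)%E.
  by move=> g0 mg goo; apply: (claim (enum I)) => // i; rewrite mem_enum.
elim: s => [|i s IHs] {}g g0 mg goo gind.
  have /choice[B BP] : forall i, exists B : set R, measurable B /\ g i = \1_B.
    by move=> i; have [//|B] := gind i; exists B.
  have mBX i : measurable (X i @^-1` B i).
    by rewrite -[_ @^-1` _]setTI; apply: mX => //; case: (BP i).
  rewrite (eq_integral (EFin \o
      \1_(\bigcap_(i in [set` [set: I]%SET]) (X i @^-1` B i)))); last first.
    move=> w _ /=; congr EFin.
    under eq_bigr => i _ do rewrite (BP i).2 indicE.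
    rewrite indicE; case: (boolP (w \in _)) => [|/negP] w_in.
      rewrite big1// => i _; rewrite mem_set//.
      by move: w_in; rewrite inE => /(_ i); apply; rewrite /= inE.
    apply/eqP/negPn/negP => prod0; apply: w_in; rewrite inE => i _ /=.
    apply: contrapT => XiB; move/eqP: prod0; apply.
    by rewrite (bigD1 i)//= memNset// mul0r.
  rewrite integral_indic ?setIT//; last first.
    by apply: fin_bigcap_measurable => // *; exact: finite_finset.
  transitivity (\prod_(i in [set: I]%SET) P (X i @^-1` B i))%E.
    by apply: indX => i; case: (BP i).
  apply: eq_big => [i|i _]; first by rewrite inE.
  rewrite (BP i).2 -[X in P X]setIT -integral_indic//.
pose upd (f : R -> R) j := if j == i then f else g j.
have updE f w : \prod_j upd f j (X j w) =
    (\prod_(j | j != i) g j (X j w)) * f (X i w).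
  rewrite (bigD1 i)//= mulrC /upd eqxx; congr (_ * _).
  by apply: eq_bigr => j /negbTE ->.
have updIE f : (\prod_j \int[P]_w (upd f j (X j w))%:E =
    (\prod_(j | j != i) \int[P]_w (g j (X j w))%:E) *
    \int[P]_w (f (X i w))%:E)%E.
  rewrite (bigD1 i)//= muleC /upd eqxx; congr (_ * _)%E.
  by apply: eq_bigr => j /negbTE ->.
have gE : upd (g i) = g by apply/funext => j; rewrite /upd; case: eqP => [->|].
rewrite -gE updIE; under eq_integral do rewrite updE.
set c := (\prod_(j | _) _)%E.
have mX' j : measurable_fun setT (fun w => g j (X j w)).
  exact: measurableT_comp.
have c0 : (0 <= c)%E.
  by apply: prode_ge0 => j _; apply: integral_ge0 => w _; rewrite lee_fin.
have IHB (B : set R) : measurable B ->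
    (\int[P]_w (\prod_(j | j != i) g j (X j w) * \1_B (X i w))%:E =
     c * \int[P]_w (\1_B (X i w))%:E)%E.
  move=> mB; rewrite -updIE -IHs; first by apply: eq_integral => w _;
    rewrite updE.
  - by move=> j r; rewrite /upd; case: eqP.
  - by move=> j; rewrite /upd; case: eqP.
  - move=> j; rewrite /upd; case: eqP => [->|_]; last exact: goo.
    rewrite (_ : integral _ _ _ = P (X i @^-1` B)).
      apply: le_lt_trans (ltry 1); apply: probability_le1.
      by rewrite -[_ @^-1` _]setTI; exact: mX.
    rewrite -[X in P X]setIT -integral_indic//.
    by rewrite -[_ @^-1` _]setTI; exact: mX.
  - move=> j js; rewrite /upd; case: eqP => [_|/eqP ji]; first by exists B.
    by apply: gind; rewrite inE negb_or ji.
have c_fin : c \is a fin_num.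
  apply: prode_fin_num => j _; rewrite ge0_fin_numE //.
  by apply: integral_ge0 => w _; rewrite lee_fin.
transitivity (\int[P]_w (fine c * g i (X i w))%:E)%E; last first.
  under eq_integral do rewrite EFinM.
  rewrite fineK// ge0_integralZl//; first exact/measurable_EFinP.
  by move=> w _; rewrite lee_fin.
apply: (ge0_integral_mul_comp_eq (F := fun w => \prod_(j | j != i) g j (X j w))
  (G := cst (fine c))) => //.
- by move=> w; apply: prodr_ge0.
- by under eq_fun do rewrite -big_filter; exact: measurable_prod.
- by move=> w; exact: fine_ge0.
move=> B mB; rewrite IHB// -[in LHS](fineK c_fin) -ge0_integralZl//.
- apply/measurable_EFinP.
  exact: (@measurableT_comp _ _ _ _ _ _ (\1_B : R -> R)).
- by rewrite lee_fin fine_ge0.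
Qed.
End product_expectation.

(** * Exponential moments of one variable *)

Section exponential_bounds.
Variable R : realType.
Implicit Types a : R.

(** For small a, exp(a) <= 1 / (1 - a) gives cosh a <= 1 / (1 - a^2), which is
at most 1 + 2 a^2; for large a, |a| <= 2 a^2 suffices. *)
Lemma cosh_le_expR a : (expR a + expR (- a)) / 2 <= expR (2 * a ^+ 2).
Proof.
have [a_small|a_big] := lerP (a ^+ 2) (1 / 2); last first.
  have abs_le : `|a| <= 2 * a ^+ 2.
    rewrite -real_normK ?num_real//; rewrite -real_normK ?num_real// in a_big.
    move: (normr_ge0 a) a_big; set b := `|a| => b0 b2.
    have : 1 / 2 < b by nra.
    nra.
  have ea : expR a <= expR (2 * a ^+ 2).
    by rewrite ler_expR (le_trans (ler_norm a)).
  have eNa : expR (- a) <= expR (2 * a ^+ 2).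
    by rewrite ler_expR (le_trans (ler_norm (- a)))// normrN.
  lra.
have inv_bound (b : R) : b < 1 -> expR b <= (1 - b)^-1.
  move=> b1; rewrite -[leLHS]invrK -expRN lef_pV2 ?posrE ?expR_gt0 ?subr_gt0//.
  exact: expR_ge1Dx.
have a1 : a < 1 by nra.
have aN1 : - a < 1 by nra.
have ea := inv_bound _ a1; have eNa := inv_bound _ aN1.
have e2 : 1 + 2 * a ^+ 2 <= expR (2 * a ^+ 2) by exact: expR_ge1Dx.
apply: (le_trans _ e2); apply: (@le_trans _ _ (((1 - a)^-1 + (1 - - a)^-1) /
  2)).
  lra.
have -> : ((1 - a)^-1 + (1 - - a)^-1) / 2 = (1 - a ^+ 2)^-1.
  by field; apply/and3P; split; apply/eqP; nra.
rewrite -(ler_pM2r (_ : 0 < 1 - a ^+ 2)); last by lra.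
rewrite mulVf; last by apply/eqP; lra.
have := sqr_ge0 a; set b := a ^+ 2 in a_small * => b0; nra.
Qed.

End exponential_bounds.

Section exponential_moments.
Context d (T : measurableType d) (R : realType) (P : probability T R).

(** By symmetry h(X) and - h(X) have the same exponential moment, which is
therefore the expectation of cosh h(X). *)
Lemma mgf_odd_le (D : probability R R) (X : {RV P >-> R}) (h : R -> R) (M : R) :
  symmetric_law D ->
  (forall A : set R, measurable A -> distribution P X A = D A) ->
  measurable_fun [set: R] h -> (forall t, h (- t) = - h t) ->
  (forall t, `|h t| <= M) ->
  (\int[P]_w (expR (h (X w)))%:E <= (expR (2 * M ^+ 2))%:E)%E.
Proof.
move=> symD lawX mh h_odd hM.
have me : measurable_fun [set: R] (EFin \o (fun t => expR (h t))).
  by apply/measurable_EFinP; exact: measurableT_comp.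
have me' : measurable_fun [set: R] (fun t => (expR (- h t))%:E).
  apply/measurable_EFinP; apply: measurableT_comp => //.
  exact: measurableT_comp.
have e0 t : (0 <= (EFin \o (fun t => expR (h t))) t)%E.
  by rewrite lee_fin expR_ge0.
have -> : (\int[P]_w (expR (h (X w)))%:E = \int[D]_t (expR (h t))%:E)%E.
  rewrite -[LHS](ge0_integral_distribution X me e0).
  by apply: eq_measure_integral => A mA _; exact: lawX.
have opp_int : (\int[D]_t (expR (h t))%:E = \int[D]_t (expR (- h t))%:E)%E.
  under [RHS]eq_integral do rewrite -h_odd.
  have mopp : measurable_fun [set: R] (fun t : R => - t) by exact:
    oppr_measurable.
  rewrite -[RHS](@ge0_integral_pushforward _ _ R R R _ mopp D setT _
    measurableT me)//.
  by apply: eq_measure_integral => A mA _; exact/esym/symD.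
have sum_le : (\int[D]_t (expR (h t))%:E + \int[D]_t (expR (- h t))%:E <=
    (2 * expR (2 * M ^+ 2))%:E)%E.
  rewrite -ge0_integralD//.
  rewrite -[leRHS]mule1 -(probability_setT D) -integral_cst//.
  apply: ge0_le_integral => //.
  - by move=> t _; rewrite adde_ge0// lee_fin expR_ge0.
  - exact: emeasurable_funD.
  move=> t _; rewrite -EFinD lee_fin.
  have := cosh_le_expR (h t).
  have : expR (2 * h t ^+ 2) <= expR (2 * M ^+ 2).
    rewrite ler_expR ler_pM2l// -real_normK ?num_real// lerXn2r ?nnegrE//.
    exact: le_trans (hM t).
  lra.
move: sum_le; rewrite -opp_int.
case: (\int[D]_t _)%E => [r| |]//; rewrite -?EFinD ?lee_fin ?leNye//; lra.
Qed.

(** The factor 1/2 makes exp(1/2) <= 2, so exp(1_B / 2) <= 1 + 1_B. *)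
Lemma mgf_indic_le (B : set R) (X : {RV P >-> R}) (q : R) :
  measurable B -> (P (X @^-1` B) <= q%:E)%E ->
  (\int[P]_w (expR (\1_B (X w) / 2))%:E <= (expR q)%:E)%E.
Proof.
move=> mB PBq.
have mXB : measurable (X @^-1` B) by rewrite -[_ @^-1` _]setTI;
  exact: measurable_funPT.
have half : expR (1 / 2) <= 2 :> R.
  rewrite -[leLHS]invrK -expRN -[leRHS]invrK lef_pV2 ?posrE ?expR_gt0//.
  by apply: le_trans (expR_ge1Dx _); lra.
apply: (@le_trans _ _ (\int[P]_w (1 + (\1_(X @^-1` B) w)%:E))%E).
  apply: ge0_le_integral => //.
  - apply/measurable_EFinP; apply: measurableT_comp => //.
    apply: measurable_funM => //.
    exact: (@measurableT_comp _ _ _ _ _ _ (\1_B : R -> R)).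
  - apply: emeasurable_funD => //; apply/measurable_EFinP.
    exact: measurable_indic.
  move=> w _; rewrite -EFinD lee_fin !indicE.
  have -> : (w \in X @^-1` B) = (X w \in B).
    by apply/idP/idP => /set_mem XwB; exact/mem_set.
  by case: (_ \in _) => /=; rewrite ?mul0r ?expR0 ?addr0//; lra.
rewrite ge0_integralD//; last first.
  by apply/measurable_EFinP; exact: measurable_indic.
rewrite integral_cst// integral_indic// setIT mul1e.
rewrite [X in (X + _)%E]probability_setT.
apply: le_trans (leeD2l _ PBq) _.
by rewrite -EFinD lee_fin expR_ge1Dx.
Qed.
End exponential_moments.

(** * A lattice substitute for the Gaussian integral *)

Section lattice.
Variables (R : realType) (p M : nat).
Local Notation code := {ffun 'I_p -> 'I_M.+1 * bool}.

(** Integer vectors with entries in [-M, M], coded by sign and absolute value.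
Zero has two codes, which only costs a constant and turns the sum over vectors
into a product over coordinates. *)
Definition lattice_point (k : code) : 'cV[R]_p :=
  \col_j ((-1) ^+ (k j).2 * ((k j).1 : nat)%:R).

(** The discrete counterpart of the Gaussian average of exp(s <k, u> - c
|k|^2), with the weights exp(- |k|^2) in place of the Gaussian density. *)
Definition lattice_sum (s c : R) (u : 'cV[R]_p) : R :=
  \sum_(k : code) expR (s * dot (lattice_point k) u
    - (1 + c) * dot (lattice_point k) (lattice_point k)).

Lemma lattice_point_norm (k : code) : dot (lattice_point k) (lattice_point k) =
  \sum_j ((k j).1 : nat)%:R ^+ 2.
Proof.
apply: eq_bigr => j _; rewrite !mxE -expr2 exprMn -exprM mulnC exprM sqrrN.
by rewrite !expr1n mul1r.
Qed.

Lemma expR1_ge2 : 2 <= expR 1 :> R.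
Proof. by apply: le_trans (expR_ge1Dx _); rewrite -natr1. Qed.

(** Comparison with a geometric series of ratio 1/2; the stronger bound 2 -
2^(1-N) is the one that passes through the induction. *)
Lemma sum_expR_sqr_le (N : nat) : \sum_(m < N) expR (- (m%:R ^+ 2)) <= 2 :> R.
Proof.
suff : \sum_(m < N) expR (- (m%:R ^+ 2)) <= 2 - 2 * 2^-1 ^+ N :> R.
  by move=> /le_trans; apply; rewrite gerBl mulr_ge0// exprn_ge0.
elim: N => [|N IHN]; first by rewrite big_ord0 expr0 mulr1 subrr.
rewrite big_ord_recr/=.
have : expR (- (N%:R ^+ 2)) <= 2^-1 ^+ N :> R.
  rewrite expRN exprVn lef_pV2 ?posrE ?expR_gt0 ?exprn_gt0//.
  apply: (@le_trans _ _ (expR N%:R)).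
    rewrite -[X in expR X]mulr1 expRM_natl lerXn2r ?nnegrE ?expR_ge0//.
    exact: expR1_ge2.
  by rewrite ler_expR -natrX ler_nat; case: (N) => // m;
    rewrite -[X in (X <= _)%N]expn1 leq_pexp2l.
rewrite [2^-1 ^+ N.+1]exprS; move: IHN; set e := expR _; set t := _ ^+ N; lra.
Qed.

(** The sum factors over coordinates, each factor being at most 4 <= exp 2. *)
Lemma lattice_mass_le :
  \sum_(k : code) expR (- dot (lattice_point k) (lattice_point k)) <=
  expR (2 * p%:R).
Proof.
under eq_bigr => k _ do rewrite lattice_point_norm -sumrN expR_sum.
rewrite -(bigA_distr_bigA (fun (j : 'I_p) (mb : 'I_M.+1 * bool) =>
  expR (- ((mb.1 : nat)%:R ^+ 2)))) /=.
(* exp 2 is written exp (2 * 1), to be bounded below by the square of exp 1 *)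
rewrite prodr_const card_ord [2 * _]mulrC expRM_natl -[X in expR X]mulr1
  lerXn2r ?nnegrE ?expR_ge0//.
  by apply: sumr_ge0 => mb _; exact: expR_ge0.
rewrite -(pair_big predT predT (fun (m : 'I_M.+1) (b : bool) =>
  expR (- ((m : nat)%:R ^+ 2)))) /=.
under eq_bigr do rewrite sumr_const card_bool.
rewrite sumrMnl -[leLHS]mulr_natl expRM_natl expr2.
apply: (@le_trans _ _ (2 * 2)); first by rewrite ler_pM2l// sum_expR_sqr_le.
by rewrite ler_pM// expR1_ge2.
Qed.

(** Round each coordinate of 2 sqrt p u / |u| towards 0.  Rounding keeps |k|^2
<= 4 p and decreases <k, u> by at most the l1 norm of u, which is at most sqrt
p |u|. *)
Lemma lattice_point_aligned (u : 'cV[R]_p) : (2 * p <= M)%N ->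
  exists k : code, dot (lattice_point k) (lattice_point k) <= 4 * p%:R /\
    Num.sqrt p%:R * norm2 u <= dot (lattice_point k) u.
Proof.
move=> pM; pose a j := 2 * Num.sqrt p%:R * `|u j 0| / norm2 u.
have a0 j : 0 <= a j by rewrite divr_ge0 ?norm2_ge0// !mulr_ge0// sqrtr_ge0.
pose m j := Num.trunc (a j).
have m_le j : (m j)%:R <= a j by rewrite truncn_le.
have m_ge j : a j - 1 <= (m j)%:R.
  by rewrite lerBlDr natr1 ltW// truncnS_gt.
have [u_eq0|u_neq0] := eqVneq (norm2 u) 0.
  exists [ffun=> (ord0, false)].
  have -> : lattice_point [ffun=> (ord0, false)] = 0.
    by apply/colP => j; rewrite !mxE ffunE/= mulr0.
  by rewrite u_eq0 mulr0 dot0r dotC dot0r mulr_ge0.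
have u0 : 0 < norm2 u by rewrite lt_neqAle eq_sym u_neq0 norm2_ge0.
have mM j : (m j < M.+1)%N.
  rewrite ltnS (leq_trans _ pM)// -(ler_nat R); apply: le_trans (m_le j) _.
  rewrite ler_pdivrMr// natrM ler_pM ?mulr_ge0 ?sqrtr_ge0 ?norm2_coord//.
  rewrite ler_pM2l//.
  have [->|p0] := eqVneq p 0%N; first by rewrite sqrtr0.
  rewrite -[leRHS]sqr_sqrtr// expr2 ler_peMl ?sqrtr_ge0//.
  by rewrite -[leLHS]sqrtr1 ler_wsqrtr// ler1n lt0n.
exists [ffun j => (Ordinal (mM j), u j 0 < 0)]; split.
  rewrite lattice_point_norm.
  under eq_bigr do rewrite ffunE/=.
  apply: (@le_trans _ _ (\sum_j a j ^+ 2)).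
    by apply: ler_sum => j _; rewrite lerXn2r ?nnegrE.
  have -> : \sum_j a j ^+ 2 =
      \sum_j (4 * p%:R / norm2 u ^+ 2) * (u j 0 * u j 0).
    apply: eq_bigr => j _; rewrite /a !exprMn real_normK ?num_real//.
    by rewrite sqr_sqrtr// exprVn -expr2; ring.
  by rewrite -mulr_sumr -/(dot u u) -sqr_norm2 divfK// sqrf_eq0.
have -> : dot (lattice_point [ffun j => (Ordinal (mM j), u j 0 < 0)]) u =
    \sum_j (m j)%:R * `|u j 0|.
  apply: eq_bigr => j _; rewrite mxE ffunE/= normrEsign.
  by rewrite -mulrA mulrCA.
apply: (@le_trans _ _ (\sum_j (a j - 1) * `|u j 0|)); last first.
  by apply: ler_sum => j _; rewrite ler_wpM2r.
have -> : \sum_j (a j - 1) * `|u j 0| =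
    2 * (Num.sqrt p%:R * norm2 u) - \sum_j `|u j 0|.
  under eq_bigr do rewrite mulrBl mul1r.
  rewrite sumrB; congr (_ - _).
  have -> : \sum_j a j * `|u j 0| =
      \sum_j (2 * Num.sqrt p%:R / norm2 u) * (u j 0 * u j 0).
    apply: eq_bigr => j _; rewrite /a -expr2 -[u j 0 ^+ 2]real_normK
      ?num_real//.
    ring.
  by rewrite -mulr_sumr -/(dot u u) -sqr_norm2; field.
have := sum_abs_le_norm2 u; lra.
Qed.

(** The sum is at least its term at the lattice vector aligned with u. *)
Lemma lattice_sum_ge (s c : R) (u : 'cV[R]_p) : (2 * p <= M)%N ->
  0 <= s -> 0 <= c ->
  expR (s * (Num.sqrt p%:R * norm2 u) - (1 + c) * (4 * p%:R)) <=
  lattice_sum s c u.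
Proof.
move=> pM s0 c0; have [k [kk_le ku_ge]] := lattice_point_aligned u pM.
rewrite /lattice_sum (bigD1 k)//=; apply: ler_wpDr.
  by apply: sumr_ge0 => j _; exact: expR_ge0.
by rewrite ler_expR lerB ?ler_wpM2l// addr_ge0.
Qed.
End lattice.

(** * Concentration of the score and of the outlier count *)

Section random_sums.
Context d (T : measurableType d) (R : realType) (P : probability T R).

(** Exponential moments of independent variables multiply. *)
Lemma integral_prod_expR_le (I : finType) (X : I -> {RV P >-> R})
    (h : I -> R -> R) (b : I -> R) :
  mutually_independent X -> (forall i, measurable_fun [set: R] (h i)) ->
  (forall i, \int[P]_w (expR (h i (X i w)))%:E <= (expR (b i))%:E)%E ->
  (\int[P]_w (expR (\sum_i h i (X i w)))%:E <= (expR (\sum_i b i))%:E)%E.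
Proof.
move=> indX mh hb; under eq_integral do rewrite expR_sum.
rewrite (ge0_integral_prod_indep (g := fun i r => expR (h i r)) indX).
- rewrite expR_sum -prodEFin.
  (* Monotonicity of products requires nonnegative factors: carry both facts. *)
  pose le_ge0 (u v : \bar R) := (0 <= u)%E /\ (u <= v)%E.
  suff [] : le_ge0 (\prod_i \int[P]_w (expR (h i (X i w)))%:E)%E
    (\prod_i (expR (b i))%:E)%E by [].
  apply: (big_ind2 le_ge0) => [|u u' v v' [u0 uu'] [v0 vv']|i _].
  - by split; rewrite ?lee01.
  - by split; [exact: mule_ge0|exact: lee_pmul].
  - by split; [apply: integral_ge0 => w _; rewrite lee_fin expR_ge0|exact: hb].
- by move=> i r; exact: expR_ge0.
- by move=> i; exact: measurableT_comp.
- by move=> i; apply: le_lt_trans (hb i) _; exact: ltry.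
Qed.

(** Markov inequality for a variable of mean at most 1, as a lower bound for
the probability of the complementary event. *)
Lemma markov_le1 (Z : T -> R) (tau : R) : 0 < tau ->
  (forall w, 0 <= Z w) -> measurable_fun setT Z ->
  (\int[P]_w (Z w)%:E <= 1)%E ->
  measurable [set w | Z w < tau^-1] /\
  ((1 - tau)%:E <= P [set w | (Z w < tau^-1)%R])%E.
Proof.
move=> tau0 Z0 mZ intZ.
have mA : measurable [set w | tau^-1 <= Z w].
  rewrite -[X in measurable X]setTI.
  exact: (measurable_fun_ler (measurable_cst _) mZ).
have compl : [set w | Z w < tau^-1] = ~` [set w | tau^-1 <= Z w].
  by apply/seteqP; split => w /=; rewrite ltNge => /negP.
split; first by rewrite compl; exact: measurableC.
rewrite compl probability_setC// EFinB.
have PA : (P [set w | (tau^-1 <= Z w)%R] <= tau%:E)%E.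
  apply: (@le_trans _ _ (\int[P]_w (tau * Z w)%:E)%E).
    rewrite -[X in P X]setIT -integral_indic//.
    apply: ge0_le_integral => //.
    - by apply/measurable_EFinP; exact: measurable_indic.
    - by apply/measurable_EFinP; exact: measurable_funM.
    move=> w _; rewrite lee_fin indicE.
    case: (boolP (w \in _)) => [|_]; last by rewrite mulr_ge0// ltW.
    by rewrite inE/= => Zw; rewrite -(mulfV (lt0r_neq0 tau0)) ler_pM2l.
  under eq_integral do rewrite EFinM.
  rewrite ge0_integralZl//; last 3 first.
  - exact/measurable_EFinP.
  - by move=> w _; rewrite lee_fin.
  - by rewrite lee_fin ltW.
  by rewrite -[leRHS]mule1 lee_pmul2l// lte_fin.
by apply: leeB.
Qed.

End random_sums.

Section huber_noise.
Context d (T : measurableType d) (R : realType) (P : probability T R).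
Variables (n p M : nat) (gamma B : R) (x : 'I_n -> 'cV[R]_p).
Variables (D : probability R R) (z : 'I_n -> {RV P >-> R}).

(** Up to the factor - 1/n, the gradient of the objective at the true
parameter. *)
Definition score (e : 'I_n -> R) : 'cV[R]_p :=
  \sum_(i < n) clip gamma (e i) *: x i.

Lemma dot_score (k : 'cV[R]_p) (e : 'I_n -> R) :
  dot k (score e) = \sum_(i < n) dot k (x i) * clip gamma (e i).
Proof.
by rewrite dotC dot_suml; apply: eq_bigr => i _; rewrite dotZl dotC mulrC.
Qed.

Lemma measurable_lattice_score (s c : R) :
  measurable_fun setT (fun w => lattice_sum M s c (score (z ^~ w))).
Proof.
apply: measurable_sum => k; apply: measurableT_comp => //.
apply: measurable_funB => //; apply: measurable_funM => //.
under eq_fun do rewrite dot_score.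
apply: measurable_sum => i; apply: measurable_funM => //.
by apply: measurableT_comp => //; exact: measurable_clip.
Qed.

(** The constant c is chosen so that exp(c |k|^2) bounds the exponential moment
of s <k, u>; only the total mass of the weights is then left. *)
Lemma lattice_score_expectation_le (s : R) : 0 < gamma ->
  symmetric_law D -> iid D z ->
  (forall v, \sum_(i < n) dot v (x i) ^+ 2 <= B * dot v v) ->
  (\int[P]_w (lattice_sum M s (2 * s ^+ 2 * gamma ^+ 2 * B) (score (z ^~ w)))%:E
    <= (expR (2 * p%:R))%:E)%E.
Proof.
move=> gamma0 symD [indz lawz] xB; set c := _ * B.
pose code := {ffun 'I_p -> 'I_M.+1 * bool}.
pose kk (k : code) := dot (lattice_point R k) (lattice_point R k).
pose a (k : code) i := s * dot (lattice_point R k) (x i).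
pose term (k : code) w := expR (\sum_(i < n) a k i * clip gamma (z i w)).
have mterm k : measurable_fun setT (term k).
  apply: measurableT_comp => //; apply: measurable_sum => i.
  apply: measurable_funM => //.
  by apply: measurableT_comp => //; exact: measurable_clip.
have term_le k : (\int[P]_w (term k w)%:E <= (expR (c * kk k))%:E)%E.
  apply: (@le_trans _ _ (expR (\sum_i 2 * (`|a k i| * gamma) ^+ 2))%:E).
    apply: (integral_prod_expR_le (h := fun i r => a k i * clip gamma r)) => //.
      by move=> i; apply: measurable_funM => //; exact: measurable_clip.
    move=> i; apply: (mgf_odd_le (h := fun r => a k i * clip gamma r) symD
      (lawz i)).
    - by apply: measurable_funM => //; exact: measurable_clip.
    - by move=> t; rewrite clipN// mulrN.
    - by move=> t; rewrite normrM ler_wpM2l// clip_le.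
  rewrite lee_fin ler_expR -mulr_sumr.
  have -> : \sum_i (`|a k i| * gamma) ^+ 2 =
      (s ^+ 2 * gamma ^+ 2) * \sum_i dot (lattice_point R k) (x i) ^+ 2.
    rewrite mulr_sumr; apply: eq_bigr => i _.
    by rewrite exprMn real_normK ?num_real// /a exprMn mulrAC.
  have := xB (lattice_point R k).
  have : 0 <= 2 * (s ^+ 2 * gamma ^+ 2).
    by apply: mulr_ge0 => //; apply: mulr_ge0; exact: sqr_ge0.
  move=> /ler_wpM2l h /h; rewrite /c /kk; lra.
have lattice_term w : (lattice_sum M s c (score (z ^~ w)))%:E =
    (\sum_(k : code) ((expR (- (1 + c) * kk k))%:E * (term k w)%:E))%E.
  rewrite /lattice_sum -sumEFin; apply: eq_bigr => k _.
  rewrite -EFinM -expRD; congr (expR _)%:E.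
  rewrite dot_score mulr_sumr addrC mulNr; congr (_ + _).
  by apply: eq_bigr => i _; rewrite mulrA.
under eq_integral do rewrite lattice_term.
rewrite ge0_integral_sum//; last 2 first.
- by move=> k; apply: measurable_funeM; exact/measurable_EFinP.
- by move=> k w _; rewrite mule_ge0// lee_fin expR_ge0.
apply: le_trans (_ : (\sum_(k : code) (expR (- kk k))%:E <= _)%E); last first.
  by rewrite sumEFin lee_fin lattice_mass_le.
apply: lee_sum => k _; rewrite ge0_integralZl//; last 2 first.
- exact/measurable_EFinP.
- by move=> w _; rewrite lee_fin expR_ge0.
apply: le_trans (lee_wpmul2l _ (term_le k)) _;
  first by rewrite lee_fin expR_ge0.
by rewrite -EFinM -expRD lee_fin ler_expR; lra.
Qed.

Definition outliers (e : 'I_n -> R) : {set 'I_n} :=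
  [set i | gamma / 2 <= `|e i|]%SET.

(** A sum of functions of the individual errors, as independence requires. *)
Lemma card_outliersE (e : 'I_n -> R) : #|outliers e|%:R =
  \sum_(i < n) \1_[set t : R | gamma / 2 <= `|t|] (e i) :> R.
Proof.
rewrite -sum1_card natr_sum big_mkcond; apply: eq_bigr => i _.
rewrite inE indicE; case: ifPn => ei; first by rewrite mem_set.
by rewrite memNset//; exact/negP.
Qed.

Lemma measurable_outlying : measurable [set t : R | gamma / 2 <= `|t|].
Proof.
rewrite -[X in measurable X]setTI.
by apply: (measurable_fun_ler (measurable_cst _)).
Qed.

Lemma measurable_outliers : measurable_fun setT
  (fun w => #|outliers (z ^~ w)|%:R : R).
Proof.
under eq_fun do rewrite card_outliersE.
apply: measurable_sum => i.
apply: (@measurableT_comp _ _ _ _ _ _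
  (\1_[set t : R | gamma / 2 <= `|t|] : R -> R)) => //.
apply: measurable_indic; exact: measurable_outlying.
Qed.

Lemma outliers_expectation_le (q : R) : mutually_independent z ->
  (forall i, P [set w | (gamma / 2 <= `|z i w|)%R] <= q%:E)%E ->
  (\int[P]_w (expR (#|outliers (z ^~ w)|%:R / 2))%:E <= (expR (q * n%:R))%:E)%E.
Proof.
move=> indz Pz; under eq_integral do rewrite card_outliersE mulr_suml.
have -> : q * n%:R = \sum_(i < n) q by rewrite sumr_const card_ord mulr_natr.
apply: (integral_prod_expR_le
  (h := fun _ r => \1_[set t : R | gamma / 2 <= `|t|] r / 2)) => // i.
  apply: measurable_funM => //; apply: measurable_indic;
    exact: measurable_outlying.
by apply: mgf_indic_le; [exact: measurable_outlying|exact: Pz].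
Qed.

End huber_noise.

(** * The good event and the theorem *)

Section noise_event.
Context d (T : measurableType d) (R : realType) (P : probability T R).
Variables (n p : nat) (gamma B q tau : R) (x : 'I_n -> 'cV[R]_p).
Variables (D : probability R R) (z : 'I_n -> {RV P >-> R}).

Local Notation ell := (ln (1 / tau)).
Local Notation scale := (Num.sqrt ((p%:R + ell) / p%:R) / (gamma * Num.sqrt B)).

(** With the scale chosen, c = 2 (p + ell) / p, and comparing the lower bound
of the lattice sum with the assumed upper bound gives sqrt (p + ell) |u| /
(gamma sqrt B) <= 15 (p + ell). *)
Lemma norm2_le_lattice_sum (u : 'cV[R]_p) :
  (0 < p)%N -> 0 < gamma -> 0 < B -> 0 < tau < 1 ->
  lattice_sum (2 * p) scale (2 * scale ^+ 2 * gamma ^+ 2 * B) u <=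
    expR (2 * p%:R + 1 + ell) ->
  norm2 u <= 15 * (gamma * Num.sqrt B * Num.sqrt (p%:R + ell)).
Proof.
move=> p0 gamma0 B0 /andP[tau0 tau1].
have ell0 : 0 < ell by rewrite ln_gt0// div1r invf_gt1.
have pR1 : 1 <= p%:R :> R by rewrite ler1n.
have pR0 : 0 < p%:R :> R by exact: lt_le_trans pR1.
have sB0 : 0 < Num.sqrt B by rewrite sqrtr_gt0.
have BE : B = Num.sqrt B ^+ 2 by rewrite sqr_sqrtr ?ltW.
have sp0 : 0 < Num.sqrt p%:R :> R by rewrite sqrtr_gt0.
set a := p%:R + ell; have a0 : 0 < a by exact: addr_gt0.
have sa0 : 0 < Num.sqrt a by rewrite sqrtr_gt0.
have scale0 : 0 <= scale by rewrite divr_ge0 ?sqrtr_ge0// mulr_ge0 ?sqrtr_ge0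
  ?ltW.
have cE : 2 * scale ^+ 2 * gamma ^+ 2 * B = 2 * (a / p%:R).
  have rE : Num.sqrt (a / p%:R) ^+ 2 = a / p%:R.
    by rewrite sqr_sqrtr// divr_ge0 ?ltW.
  rewrite exprMn rE exprVn exprMn -BE.
  by field; rewrite !gt_eqF.
have scaleE : scale * (Num.sqrt p%:R * norm2 u) =
    Num.sqrt a * norm2 u / (gamma * Num.sqrt B).
  by rewrite sqrtrM ?ltW// sqrtrV ?ltW//; field; rewrite !gt_eqF.
rewrite cE => sum_le.
have c0 : 0 <= 2 * (a / p%:R) by rewrite mulr_ge0// divr_ge0 ?ltW.
have := le_trans (lattice_sum_ge u (leqnn _) scale0 c0) sum_le.
rewrite ler_expR scaleE => le_exp.
have {}le_exp : Num.sqrt a * norm2 u / (gamma * Num.sqrt B) <= 15 * a.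
  move: le_exp.
  have -> : (1 + 2 * (a / p%:R)) * (4 * p%:R) = 4 * p%:R + 8 * a.
    by field; rewrite gt_eqF.
  rewrite /a; lra.
move: le_exp; rewrite ler_pdivrMr ?mulr_gt0// => le_exp.
rewrite -(ler_pM2l sa0); apply: (le_trans le_exp).
rewrite -[X in 15 * X](sqr_sqrtr (ltW a0)) le_eqVlt; apply/orP; left.
by apply/eqP; ring.
Qed.

(** Each of the two moments, divided by its bound and halved, contributes at
most 1/2 to the mean of Z.  On the event Z < 1 / tau each of them is therefore
at most 2 / tau <= exp(1 + ell) times its bound; taking one event avoids
splitting tau, which would cost a term log 2 in the rate. *)
Lemma good_noise_event :
  (0 < p)%N -> 0 < gamma -> 0 < B -> 0 < tau < 1 ->
  symmetric_law D -> iid D z ->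
  (forall v, \sum_(i < n) dot v (x i) ^+ 2 <= B * dot v v) ->
  (forall i, P [set w | (gamma / 2 <= `|z i w|)%R] <= q%:E)%E ->
  exists E : set T, [/\ measurable E, ((1 - tau)%:E <= P E)%E &
    forall w, E w ->
      norm2 (score gamma x (z ^~ w)) <=
        15 * (gamma * Num.sqrt B * Num.sqrt (p%:R + ell)) /\
      #|outliers gamma (z ^~ w)|%:R <= 2 * (q * n%:R + 1 + ell)].
Proof.
move=> p0 gamma0 B0 tau01 symD iidz xB Pz; have /andP[tau0 tau1] := tau01.
pose Z1 w := lattice_sum (2 * p) scale (2 * scale ^+ 2 * gamma ^+ 2 * B)
  (score gamma x (z ^~ w)).
pose Z2 w : R := expR (#|outliers gamma (z ^~ w)|%:R / 2).
pose Z w := expR (- (2 * p%:R)) / 2 * Z1 w + expR (- (q * n%:R)) / 2 * Z2 w.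
have Z1_ge0 w : 0 <= Z1 w by apply: sumr_ge0 => k _; exact: expR_ge0.
have Z2_ge0 w : 0 <= Z2 w by exact: expR_ge0.
have mZ1 : measurable_fun setT Z1 by exact: measurable_lattice_score.
have mZ2 : measurable_fun setT Z2.
  apply: measurableT_comp => //; apply: measurable_funM => //.
  exact: measurable_outliers.
have Z_ge0 w : 0 <= Z w by rewrite addr_ge0 ?mulr_ge0 ?expR_ge0.
have mZ : measurable_fun setT Z.
  by apply: measurable_funD; apply: measurable_funM.
have scaled_le (e : R) (F : T -> R) : (forall w, 0 <= F w) -> measurable_fun
  setT F ->
    (\int[P]_w (F w)%:E <= (expR e)%:E)%E ->
    (\int[P]_w (expR (- e) / 2 * F w)%:E <= (1 / 2)%:E)%E.
  move=> F0 mF Fle; under eq_integral do rewrite EFinM.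
  rewrite ge0_integralZl//; last 2 first.
  - exact/measurable_EFinP.
  - by move=> w _; rewrite lee_fin.
  apply: le_trans (lee_wpmul2l _ Fle) _; first by rewrite lee_fin mulr_ge0
    ?expR_ge0.
  by rewrite -EFinM lee_fin mulrAC -expRD addNr expR0.
have intZ : (\int[P]_w (Z w)%:E <= 1)%E.
  under eq_integral do rewrite EFinD.
  rewrite ge0_integralD//; last 4 first.
  - by move=> w _; rewrite lee_fin mulr_ge0// mulr_ge0 ?expR_ge0.
  - by apply/measurable_EFinP; exact: measurable_funM.
  - by move=> w _; rewrite lee_fin mulr_ge0 ?expR_ge0// mulr_ge0 ?expR_ge0.
  - by apply/measurable_EFinP; exact: measurable_funM.
  rewrite (_ : 1%E = ((1 / 2)%:E + (1 / 2)%:E)%E);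
    last by rewrite -EFinD -splitr.
  apply: leeD; apply: scaled_le => //.
    exact: (lattice_score_expectation_le _ _ gamma0 symD iidz xB).
  exact: (outliers_expectation_le iidz.1 Pz).
have [mE PE] := markov_le1 tau0 Z_ge0 mZ intZ.
exists [set w | Z w < tau^-1]; split => // w /= Zw.
have two_tau : 2 * tau^-1 <= expR (1 + ell).
  rewrite expRD lnK ?div1r ?posrE ?invr_gt0// ler_pM2r ?invr_gt0//.
  exact: expR1_ge2.
have split_le (e F G : R) : 0 <= G -> expR (- e) / 2 * F + G < tau^-1 ->
    F <= expR (e + (1 + ell)).
  move=> G0 lt_tau; rewrite expRD -ler_pdivrMl ?expR_gt0// -expRN.
  by apply: le_trans two_tau; lra.
split.
  apply: norm2_le_lattice_sum => //.
  rewrite -addrA; apply: split_le Zw.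
  by rewrite !mulr_ge0 ?expR_ge0.
have : Z2 w <= expR (q * n%:R + (1 + ell)).
  apply: (split_le _ _ (expR (- (2 * p%:R)) / 2 * Z1 w)).
    by rewrite !mulr_ge0 ?expR_ge0.
  by rewrite addrC.
by rewrite ler_expR; lra.
Qed.

End noise_event.

Lemma convex_ball2 (R : realType) (p : nat) (c : 'cV[R]_p) (r : R) :
  convex_set (ball2 c r).
Proof.
move=> a b t /set_mem /= a_in /set_mem /= b_in; apply/mem_set => /=.
have t0 : 0 <= t%:num by [].
have t1 : 0 <= 1 - t%:num by rewrite subr_ge0.
change (norm2 (t%:num *: a + (1 - t%:num) *: b - c) <= r).
have -> : t%:num *: a + (1 - t%:num) *: b - c =
    t%:num *: (a - c) + (1 - t%:num) *: (b - c).
  by rewrite !scalerBr addrACA -opprD -scalerDl addrC subrKC scale1r addrC.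
apply: le_trans (norm2D_le _ _) _; rewrite !norm2Z !ger0_norm//.
have := ler_wpM2l t0 a_in; have := ler_wpM2l t1 b_in; lra.
Qed.

Lemma sqrtrD_le (R : realType) (a b : R) : 0 <= a -> 0 <= b ->
  Num.sqrt (a + b) <= Num.sqrt a + Num.sqrt b.
Proof.
move=> a0 b0; rewrite -ler_sqr ?nnegrE ?addr_ge0 ?sqrtr_ge0//.
rewrite sqrrD !sqr_sqrtr ?addr_ge0//.
have := mulr_ge0 (sqrtr_ge0 a) (sqrtr_ge0 b); rewrite mulr2n; lra.
Qed.

(** Both bounds restate the sample size condition; the second uses L <= U and a
>= 1. *)
Lemma sample_size_bounds (R : realType) (K eps L U a n : R) :
  1 <= K -> 0 < eps < 1 -> 0 < L <= U -> 1 <= a -> 0 < n ->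
  K ^+ 2 * (U ^+ 2 * a / (L ^+ 2 * eps ^+ 2)) <= n ->
  Num.sqrt (a / n) <= L * eps / (K * U) /\ K <= eps * n.
Proof.
move=> K1 /andP[eps0 eps1] /andP[L0 LU] a1 n0.
have K0 : 0 < K by lra.
have U0 : 0 < U by lra.
have a0 : 0 < a by lra.
rewrite mulrA ler_pdivrMr ?mulr_gt0 ?exprn_gt0// => n_large; split.
  rewrite -ler_sqr ?nnegrE ?sqrtr_ge0//; last first.
    by rewrite divr_ge0// mulr_ge0// ltW.
  rewrite sqr_sqrtr; last by rewrite divr_ge0 ?ltW.
  rewrite expr_div_n !exprMn ler_pdivrMr// mulrAC.
  rewrite ler_pdivlMr ?mulr_gt0 ?exprn_gt0//; move: n_large; lra.
have U2 : 0 < U ^+ 2 by exact: exprn_gt0.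
have L2U2 : L ^+ 2 <= U ^+ 2 by rewrite lerXn2r// nnegrE ltW.
have neps2 : 0 <= n * eps ^+ 2 by rewrite mulr_ge0 ?exprn_ge0 ?ltW.
have K2a : K ^+ 2 * a <= n * eps ^+ 2.
  by rewrite -(ler_pM2r U2); have := ler_wpM2l neps2 L2U2; move: n_large; lra.
have K2 : K <= K ^+ 2 * a.
  have K_le : K <= K ^+ 2 by rewrite expr2 ler_peMr// ltW.
  by rewrite -[leLHS]mulr1 ler_pM// ltW.
apply: (le_trans K2); apply: (le_trans K2a).
by rewrite expr2 mulrA [leRHS]mulrC ler_piMr ?mulr_ge0 ?ltW.
Qed.

(* The event E is required to be measurable, but the selection betahat of a
   minimizer is not. *)
Theorem theorem3p1 (R : realType) :
  exists c1 c2 C3 C4 c5 : R,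
    [/\ 0 < c1, 0 < c2, 0 < C3, 0 < C4 & 0 < c5] /\
    forall (n p : nat) (x : 'I_n -> 'cV[R]_p) (eps L U : R),
      0 < eps < 1 -> 0 < L -> 0 < U ->
      weak_stability eps L U x ->
    forall (d : measure_display) (T : measurableType d) (P : probability T R)
      (D : probability R R) (z : 'I_n -> {RV P >-> R})
      (betastar : 'cV[R]_p) (y : 'I_n -> T -> R),
      symmetric_law D -> iid D z ->
      (forall i w, y i w = dot (x i) betastar + z i w) ->
    forall tau gamma : R,
      0 < tau < 1 ->
      ln (1 / tau) / n%:R <= c1 * eps ->
      0 < gamma ->
      (forall i, (P [set w | (gamma / 2 <= `|z i w|)%R] <= (c2 * eps)%:E)%E) ->
    forall betahat : T -> 'cV[R]_p,
      (forall w, argmin (huber_objective gamma x (y ^~ w)) (betahat w)) ->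
      C3 * (U ^+ 2 * (p%:R + ln (1 / tau)) / (L ^+ 2 * eps ^+ 2)) <= n%:R ->
    exists E : set T,
      [/\ measurable E,
          ((1 - tau)%:E <= P E)%E,
          forall w, E w ->
            norm2 (betahat w - betastar) <=
              C4 * (gamma * Num.sqrt U / L *
                    (Num.sqrt (p%:R / n%:R) + Num.sqrt (ln (1 / tau) / n%:R)))
        & forall w, E w ->
            strongly_convex L
              (ball2 (betahat w) (c5 * (eps * gamma / Num.sqrt U)))
              (huber_objective gamma x (y ^~ w))].
Proof.
(* The error bound 30 (gamma sqrt U / L) rate must be at most eps gamma /
   (8 sqrt U), half the radius of strong convexity: hence K = 30 * 8. *)
have [K [K1 KE]] : exists K : R, 16 <= K /\ K = 240.
  by exists 240; split => //; rewrite ler_nat.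
have K0 : 0 < K by lra.
exists (1 / 16), (1 / 8), (K ^+ 2), 30, (1 / 8); split.
  by split => //; rewrite exprn_gt0.
move=> n p x eps L U eps01 L0 U0 stable d T P D z betastar y symD iidz yE.
move=> tau gamma tau01 ell_small gamma0 Pz betahat bmin n_large.
have /andP[eps0 eps1] := eps01; have /andP[tau0 tau1] := tau01.
have p0 := weak_stability_dim eps0 L0 stable.
set ell := ln (1 / tau) in ell_small n_large *.
have ell0 : 0 < ell by rewrite ln_gt0// div1r invf_gt1.
have pR1 : 1 <= p%:R :> R by rewrite ler1n.
set a := p%:R + ell in n_large; have a1 : 1 <= a by rewrite /a; lra.
have card_all : (1 - eps) * n%:R <= #|[set: 'I_n]%SET|%:R.
  by rewrite cardsT card_ord ler_piMl//; lra.
have LU : L <= U.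
  by have [Lmin minmax maxU] := stable _ card_all;
    exact: le_trans (le_trans Lmin minmax) maxU.
have a0 : 0 < a by lra.
have nR0 : 0 < n%:R :> R.
  apply: lt_le_trans n_large.
  by rewrite mulr_gt0 ?exprn_gt0// divr_gt0 ?mulr_gt0 ?exprn_gt0.
have n0 : (0 < n)%N by rewrite -(ltr0n R).
have sU0 : 0 < Num.sqrt U by rewrite sqrtr_gt0.
have sn0 : 0 < Num.sqrt n%:R :> R by rewrite sqrtr_gt0.
pose rate := Num.sqrt (a / n%:R).
have rate_sub : rate <= Num.sqrt (p%:R / n%:R) + Num.sqrt (ell / n%:R).
  by rewrite /rate /a mulrDl sqrtrD_le// divr_ge0// ltW.
have [] := @sample_size_bounds _ K eps L U a n%:R.
- lra.
- exact: eps01.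
- by rewrite L0.
- exact: a1.
- exact: nR0.
- exact: n_large.
rewrite -/rate => rate_le eps_n.
have xB v : \sum_(i < n) dot v (x i) ^+ 2 <= n%:R * U * dot v v.
  have /andP[_] := weak_stability_form v eps0 L0 stable card_all.
  rewrite -(ler_pM2l nR0) mulVKf ?gt_eqF// mulrA; apply: le_trans.
  rewrite le_eqVlt; apply/orP; left; apply/eqP.
  by apply: eq_big => [i|i _]; rewrite ?inE// dotC.
have B0 : 0 < n%:R * U by exact: mulr_gt0.
have [E [mE PE E_good]] := good_noise_event p0 gamma0 B0 tau01 symD iidz xB Pz.
pose kappa := 15 * (gamma * Num.sqrt U * rate).
pose radius := eps * gamma / Num.sqrt U / 4.
have kappa_le : 2 * kappa / L <= radius / 2.
  have UE : U = Num.sqrt U ^+ 2 by rewrite sqr_sqrtr ?ltW.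
  have -> : radius / 2 =
      2 * (15 * (gamma * Num.sqrt U * (L * eps / (K * Num.sqrt U ^+ 2)))) / L.
    by rewrite /radius KE; field; rewrite gt_eqF// gt_eqF.
  rewrite -UE ler_pM2r ?invr_gt0// ler_pM2l// ler_pM2l// ler_pM2l//.
  exact: mulr_gt0.
have radius0 : 0 < radius by rewrite /radius !divr_gt0// mulr_gt0.
have few w : E w ->
    #|[set i | (gamma / 2 <= `|y i w - dot (x i) betastar|)%R]%SET|%:R
      <= eps / 2 * n%:R.
  move=> /E_good[_]; rewrite -/ell.
  rewrite (_ : [set i | _]%SET = outliers gamma (z ^~ w)); last first.
    by apply: eq_finset => i; rewrite yE addrC addKr.
  (* 2 (eps n / 8 + 1 + ell) <= eps n / 2 since 16 <= eps n *)
  have : ell <= 1 / 16 * eps * n%:R by rewrite -ler_pdivrMr.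
  move: (le_trans K1 eps_n); lra.
have error w : E w -> norm2 (betahat w - betastar) <= 2 * kappa / L.
  move=> Ew; apply: (minimizer_error eps01 L0 U0 gamma0 n0 stable (few w Ew)).
  - exact: bmin.
  - rewrite /huber_gradient norm2Z normrN ger0_norm ?invr_ge0// ler_pdivrMl//.
    under eq_bigr do rewrite yE addrC addKr.
    apply: le_trans (E_good w Ew).1 _.
    rewrite /kappa /rate sqrtrM ?(ltW nR0)// sqrtrM ?(ltW a0)// sqrtrV ?(ltW
      nR0)//.
    have nE : n%:R = Num.sqrt n%:R ^+ 2 :> R by rewrite sqr_sqrtr ?ltW.
    rewrite -/ell -/a; set sn := Num.sqrt n%:R in nE sn0 *.
    by rewrite nE le_eqVlt; apply/orP; left; apply/eqP; field; rewrite gt_eqF.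
  - by apply: le_lt_trans kappa_le _; rewrite -/radius; lra.
exists E; split => // w Ew.
  apply: le_trans (error w Ew) _.
  have -> : 2 * kappa / L = 30 * (gamma * Num.sqrt U / L * rate).
    by rewrite /kappa; field; rewrite gt_eqF.
  by rewrite ler_pM2l// ler_pM2l// divr_gt0// mulr_gt0.
(* eps gamma / (8 sqrt U) is half of [radius], and so is the error bound. *)
have near b : ball2 (betahat w) (1 / 8 * (eps * gamma / Num.sqrt U)) b ->
    norm2 (b - betastar) <= radius.
  rewrite /ball2/= => b_in; rewrite -(subrKA (betahat w)).
  apply: le_trans (norm2D_le _ _) _.
  have := le_trans (error w Ew) kappa_le; rewrite /radius; lra.
split.
- exact: convex_ball2.
- by move=> b _; have [] := differentiable_huber_objective x (y ^~ w) b gamma0.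
- have -> : gradient (huber_objective gamma x (y ^~ w)) =
      huber_gradient gamma x (y ^~ w).
    by apply/funext => b; have [] := differentiable_huber_objective x (y ^~ w)
      b gamma0.
  exact/continuous_subspaceT/continuous_huber_gradient.
move=> b b' /near b_near /near b'_near.
have [_ ->] := differentiable_huber_objective x (y ^~ w) b gamma0.
exact: (huber_objective_locally_strongly_convex eps01 L0 U0 gamma0 n0 stable
  (few w Ew)).
Qed.
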